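(* Let $N\ge 1$ be an integer, let $0<\beta_A<\beta_B<1$, and set $\rho_A:=\frac{\beta_A}{1-\beta_A}$, $\rho_B:=\frac{\beta_B}{1-\beta_B}$. The invariant measure of the continuous-time Markov chain on $\Omega_N=\mathbb{N}_0^{\{1,\dots,N\}}$ with generator $L_N=L_N^{\mathrm{bulk}}+L_N^{\mathrm{bound}}$ (the boundary driven discrete harmonic model with parameter $s=1/2$; invariance is expressed by the stationarity condition $\mu L_N=0$) is given by $$\mu_N^{\rho_A,\rho_B}(\eta)=\frac{1}{|O_N^{\rho_A,\rho_B}|}\int_{O_N^{\rho_A,\rho_B}} d\underline m\ \mathcal{G}_{\underline m}(\eta),\qquad \eta=(\eta_1,\dots,\eta_N)\in\Omega_N,$$ where $O_N^{\rho_A,\rho_B}=\{\underline m\in\mathbb{R}^N:\rho_A\le m_1\le\dots\le m_N\le\rho_B\}$, $|O_N^{\rho_A,\rho_B}|=\frac{(\rho_B-\rho_A)^N}{N!}$ is its Lebesgue volume, and $\mathcal{G}_{\underline m}(\eta)=\prod_{x=1}^N\frac{1}{1+m_x}\left(\frac{m_x}{1+m_x}\right)^{\eta_x}$ is the product of geometric distributions of means $m_1,\dots,m_N$.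
   Context: Let $\Lambda_N=\{1,\dots,N\}$ and let $\mathbb{N}_0$ be the set of non-negative integers. A configuration is $\eta=(\eta_1,\dots,\eta_N)\in\Omega_N=\mathbb{N}_0^{\Lambda_N}$, where $\eta_x$ is the number of particles at $x$. For $x\in\Lambda_N$, $\delta_x\in\Omega_N$ is the configuration with $\delta_x(x)=1$ and $\delta_x(y)=0$ for $y\ne x$. The generator, acting on bounded functions $f:\Omega_N\to\mathbb{R}$, is $L_N=L_N^{\mathrm{bulk}}+L_N^{\mathrm{bound}}$ with $$L_N^{\mathrm{bulk}}f(\eta)=\sum_{\substack{x,y\in\Lambda_N\\|x-y|=1}}\sum_{k=1}^{\eta_x}\frac1k\left[f(\eta-k\delta_x+k\delta_y)-f(\eta)\right],$$ $$L_N^{\mathrm{bound}}f(\eta)=\sum_{k=1}^{\eta_1}\frac1k\left[f(\eta-k\delta_1)-f(\eta)\right]+\sum_{k=1}^{\infty}\frac{\beta_A^k}{k}\left[f(\eta+k\delta_1)-f(\eta)\right]+\sum_{k=1}^{\eta_N}\frac1k\left[f(\eta-k\delta_N)-f(\eta)\right]+\sum_{k=1}^{\infty}\frac{\beta_B^k}{k}\left[f(\eta+k\delta_N)-f(\eta)\right].$$ The first sum in the bulk part runs over ordered pairs $(x,y)$. For a measure $\mu$ on $\Omega_N$, the stationarity condition $\mu L_N=0$ reads: for all $\eta\in\Omega_N$, $$\mu(\eta)\left[\sum_{k=1}^{\infty}\frac{\beta_A^k}{k}+\sum_{x=1}^N\sum_{k=1}^{\eta_x}\frac2k+\sum_{k=1}^{\infty}\frac{\beta_B^k}{k}\right]=\sum_{k=1}^{\eta_1}\mu(\eta-k\delta_1)\frac{\beta_A^k}{k}+\sum_{k=1}^{\infty}\mu(\eta+k\delta_1)\frac1k$$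 $$+\sum_{x=1}^{N-1}\sum_{k=1}^{\eta_{x+1}}\mu(\eta+k\delta_x-k\delta_{x+1})\frac1k+\sum_{x=2}^{N}\sum_{k=1}^{\eta_{x-1}}\mu(\eta+k\delta_x-k\delta_{x-1})\frac1k+\sum_{k=1}^{\eta_N}\mu(\eta-k\delta_N)\frac{\beta_B^k}{k}+\sum_{k=1}^{\infty}\mu(\eta+k\delta_N)\frac1k.$$ *)

(* Defs.v *)
From HB Require Import structures.
From mathcomp Require Import all_boot all_order all_algebra.
From mathcomp Require Import all_classical all_reals all_analysis.

Set Implicit Arguments.
Unset Strict Implicit.
Unset Printing Implicit Defensive.

Import Order.TTheory GRing.Theory Num.Theory.
Import numFieldNormedType.Exports.

Local Open Scope classical_set_scope.
Local Open Scope ring_scope.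

(** Lebesgue measure on R^n, R^n being [n.-tuple R] with the product
    sigma-algebra: [lebesgue_tuple n.+1] is the image of the product measure
    [lebesgue_measure \x lebesgue_tuple n] under (x, t) |-> x :: t.
    Lemma [lebesgue_tuple_box] is the defining property on boxes. *)
Section lebesgue_tuple.
Context {R : realType}.
Local Notation RT := (measurableTypeR R).

Definition tuple_cons n (p : RT * n.-tuple RT) : n.+1.-tuple RT :=
  [tuple of p.1 :: p.2].

Lemma measurable_tuple_cons n : measurable_fun setT (@tuple_cons n).
Proof. exact: measurable_cons. Qed.

Definition lebesgue_cons n
    (mu : {sigma_finite_measure set (n.-tuple RT) -> \bar R}) :
    set (n.+1.-tuple RT) -> \bar R :=
  pushforward (@lebesgue_measure R \x mu)%E (@tuple_cons n).

Section step.
Variables (n : nat) (mu : {sigma_finite_measure set (n.-tuple RT) -> \bar R}).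

Let lebesgue_cons0 : lebesgue_cons mu set0 = 0%E.
Proof. by rewrite /lebesgue_cons /pushforward preimage_set0 measure0. Qed.

Let lebesgue_cons_ge0 A : (0 <= lebesgue_cons mu A)%E.
Proof. by apply: integral_ge0 => x _; exact: measure_ge0. Qed.

Let lebesgue_cons_sigma_additive : semi_sigma_additive (lebesgue_cons mu).
Proof.
move=> F mF tF mUF; rewrite /lebesgue_cons /pushforward preimage_bigcup.
have mc B : measurable B -> measurable (@tuple_cons n @^-1` B).
  by move=> mB; rewrite -[X in measurable X]setTI; exact: measurable_tuple_cons.
apply: measure_semi_sigma_additive.
- by move=> k; exact: mc.
- apply/trivIsetP => /= i j _ _ ij; rewrite -preimage_setI.
  by move/trivIsetP : tF => /(_ _ _ _ _ ij) ->//; rewrite preimage_set0.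
- by rewrite -preimage_bigcup; exact: mc.
Qed.

HB.instance Definition _ := isMeasure.Build _ _ _ (lebesgue_cons mu)
  lebesgue_cons0 lebesgue_cons_ge0 lebesgue_cons_sigma_additive.

Let lebesgue_cons_sigma_finite : sigma_finite setT (lebesgue_cons mu).
Proof.
have mh : measurable_fun [set: n.+1.-tuple RT] (fun t => thead t : RT).
  exact: measurable_tnth.
have mb := @measurable_behead _ RT n.
have [F FT mF] := @sigma_finiteT _ _ _ (@lebesgue_measure R).
have [G GT mG] := @sigma_finiteT _ _ _ mu.
pose H (k : nat * nat) := ((fun t : n.+1.-tuple RT => thead t : RT) @^-1` F k.1)
   `&` ((fun t : n.+1.-tuple RT => [tuple of behead t] : n.-tuple RT) @^-1` G k.2).
pose K i := if (unpickle i : option (nat * nat)) is Some k then H k else set0.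
exists K.
  apply/esym/seteqP; split => // t _.
  have : [set: RT] (thead t) by [].
  rewrite FT => -[i _ Fi].
  have : [set: n.-tuple RT] [tuple of behead t] by [].
  rewrite GT => -[j _ Gj].
  by exists (pickle (i, j)) => //; rewrite /K pickleK; split.
move=> i; rewrite /K; case: unpickle => [[a b]|]; last first.
  by split => //; rewrite measure0.
split.
  apply: measurableI; rewrite -[X in measurable X]setTI.
  - by apply: mh => //; exact: (mF a).1.
  - by apply: mb => //; exact: (mG b).1.
rewrite /lebesgue_cons /pushforward.
have -> : @tuple_cons n @^-1` H (a, b) = F a `*` G b.
  apply/seteqP; split => -[x t]; rewrite /H /tuple_cons /=.
    rewrite theadE (_ : [tuple of behead (x :: t)] = t)//.
    exact/val_inj.
  rewrite theadE (_ : [tuple of behead (x :: t)] = t)//.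
  exact/val_inj.
rewrite product_measure1E; [|exact: (mF a).1|exact: (mG b).1].
by apply: lte_mul_pinfty; rewrite ?measure_ge0// ?ge0_fin_numE ?measure_ge0//;
  [exact: (mF a).2|exact: (mG b).2].
Qed.

HB.instance Definition _ := Measure_isSigmaFinite.Build _ _ _ (lebesgue_cons mu)
  lebesgue_cons_sigma_finite.
End step.

Fixpoint lebesgue_tuple n : {sigma_finite_measure set (n.-tuple RT) -> \bar R} :=
  if n is n'.+1 then lebesgue_cons (lebesgue_tuple n') else \d_[tuple].

Lemma lebesgue_tuple_box n (A : 'I_n -> set RT) :
  (forall i, measurable (A i)) ->
  lebesgue_tuple n [set t | forall i, A i (tnth t i)] =
    (\prod_(i < n) lebesgue_measure (A i))%E.
Proof.
elim: n A => [|n IH] A mA.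
  rewrite big_ord0 /= diracE mem_set//; by case.
rewrite big_ord_recl -(IH (fun i => A (lift ord0 i)))//.
rewrite /= /lebesgue_cons /pushforward.
set B := [set t : n.-tuple RT | _].
have -> : @tuple_cons n @^-1` [set t | forall i, A i (tnth t i)] =
    A ord0 `*` B.
  apply/seteqP; split => -[x t] /=.
    move=> H; split; first exact: (H ord0).
    by move=> i; have := H (lift ord0 i); rewrite tnthS.
  move=> [/= H0 tB] i; case: (unliftP ord0 i) => [j|] ->; rewrite ?tnthS//.
rewrite product_measure1E//.
have -> : B = \bigcap_(i in [set: 'I_n]) (@tnth n RT ^~ i @^-1` A (lift ord0 i)).
  by apply/seteqP; split => t; [move=> H i _; exact: H|move=> H i; exact: H].
apply: fin_bigcap_measurable => // i _.
by rewrite -[X in measurable X]setTI; exact: measurable_tnth.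
Qed.

End lebesgue_tuple.

Notation config N := (N.-tuple nat).

Definition add_particles N (k : nat) (x : 'I_N) (eta : config N) : config N :=
  [tuple (tnth eta y + (y == x) * k)%N | y < N].

(** Truncated subtraction: only meant for [k <= tnth eta x]. *)
Definition remove_particles N (k : nat) (x : 'I_N) (eta : config N) :
    config N :=
  [tuple (tnth eta y - (y == x) * k)%N | y < N].

Section model.
Context {R : realType}.
Local Notation RT := (measurableTypeR R).

(** The stationarity condition mu L_N = 0 on N = n.+1 sites, site 1 being
    [ord0] and site N being [ord_max].  It is an equality in [\bar R] between
    series of nonnegative terms, so no convergence is presupposed; the left-hand
    side is finite when 0 <= betaA, betaB < 1 and mu is a finite measure. *)
Definition stationary n (betaA betaB : R)
    (mu : set (config n.+1) -> \bar R) : Prop :=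
  forall eta : config n.+1,
  (mu [set eta] *
     (\sum_(1 <= k <oo) (betaA ^+ k / k%:R)%:E
      + \sum_(x < n.+1) \sum_(1 <= k < (tnth eta x).+1) (2 / k%:R)%:E
      + \sum_(1 <= k <oo) (betaB ^+ k / k%:R)%:E)
   = \sum_(1 <= k < (tnth eta ord0).+1)
       mu [set remove_particles k ord0 eta] * (betaA ^+ k / k%:R)%:E
     + \sum_(1 <= k <oo) mu [set add_particles k ord0 eta] * (k%:R^-1)%:E
     + \sum_(x < n.+1) \sum_(y < n.+1 | y == x.+1 :> nat)
         \sum_(1 <= k < (tnth eta y).+1)
           mu [set add_particles k x (remove_particles k y eta)] * (k%:R^-1)%:E
     + \sum_(x < n.+1) \sum_(y < n.+1 | x == y.+1 :> nat)
         \sum_(1 <= k < (tnth eta y).+1)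
           mu [set add_particles k x (remove_particles k y eta)] * (k%:R^-1)%:E
     + \sum_(1 <= k < (tnth eta ord_max).+1)
         mu [set remove_particles k ord_max eta] * (betaB ^+ k / k%:R)%:E
     + \sum_(1 <= k <oo) mu [set add_particles k ord_max eta] * (k%:R^-1)%:E)%E.

Definition geometric_product N (m : N.-tuple RT) (eta : config N) : R :=
  \prod_(x < N)
    (1 / (1 + tnth m x) * (tnth m x / (1 + tnth m x)) ^+ tnth eta x).

(** rhoA <= m_1 <= ... <= m_N <= rhoB. *)
Definition ordered_means N (rhoA rhoB : R) : set (N.-tuple RT) :=
  [set m : N.-tuple RT | path <=%R rhoA (rcons m rhoB)].

Definition mixture N (rhoA rhoB : R) (eta : config N) : \bar R :=
  ((lebesgue_tuple N (ordered_means rhoA rhoB))^-1 *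
   \int[lebesgue_tuple N]_(m in ordered_means rhoA rhoB)
     (geometric_product m eta)%:E)%E.

End model.

(* Main.v *)
(** Stationarity.  Put [b = m / (1 + m)], so that the weight of k particles at a
    site of mean m is geo k m = (1 - b) b^k, and read the reservoirs as sites of
    fixed means m_0 = rhoA and m_{N+1} = rhoB.  Adding ln (1 + m_x) at the inner
    sites to both sides, the balance equation integrated against the product of
    geometric laws splits into one identity per site x, where the neighbouring
    means a = m_{x-1} and c = m_{x+1} are frozen and m = m_x runs over [a, c]:
    the integral of
      geo k m * (h (b_a / b_m) + h (b_c / b_m) - 2 h 1
                 + 2 ln (1 + m) - ln (1 + a) - ln (1 + c))
    vanishes, where h t = sum_{1 <= i <= k} t^i / i.  Indeed, for the symmetric
    function
      S m c = ln (1 + m) h b_c + ln (1 + c) h b_m - ln (1 + m) ln (1 + c)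
              - sum_{i + j <= k} b_m^i b_c^j / (i j),
    the integrand is the derivative in m of S m a + S m c - S m m, whose values at
    m = a and m = c both equal S a c.

    Uniqueness.  If p and q are stationary probabilities, u = max (p - q, 0)
    satisfies (exit rate) u <= (inflow of u).  Test this against t^|eta|, with
    |eta| the number of particles: moves in the bulk preserve |eta|, creations
    decrease t^|eta|, and annihilations contribute an error bounded by
    min (1, (1 - t) |eta|).  Letting t tend to 1 gives equality, and by
    irreducibility u vanishes identically or nowhere; in both cases p and q are
    comparable, hence equal. *)
Require Import Defs.
From HB Require Import structures.
From mathcomp Require Import all_boot all_order all_algebra.
From mathcomp Require Import all_classical all_reals all_analysis.
From mathcomp Require Import ring lra zify.

Set Implicit Arguments.
Unset Strict Implicit.
Unset Printing Implicit Defensive.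

Import Order.TTheory GRing.Theory Num.Theory.
Import numFieldNormedType.Exports.
(* Without this import the measurable structure of [\bar R] is not inferred. *)
Import measurable_realfun.

Local Open Scope classical_set_scope.
Local Open Scope ring_scope.

(** * Integration over ordered means *)

Section ordered_integrals.
Context {R : realType}.
Local Notation RT := (measurableTypeR R).
Variable B : R.

Lemma ordered_means_cons n (a x : R) (t : n.-tuple RT) :
  ordered_means a B (tuple_cons (x, t)) <-> a <= x /\ ordered_means x B t.
Proof. by rewrite /ordered_means /=; split=> [/andP//|[-> ->]]. Qed.

Lemma ordered_means_le n (a : R) (t : n.-tuple RT) :
  ordered_means a B t -> a <= B.
Proof.
rewrite /ordered_means /=; case: t => t /= _.
elim: t a => [|x t IH] a /=; first by rewrite andbT.
by move=> /andP[ax /IH]; exact: le_trans.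
Qed.

(** The sequence [a :: rcons t B] puts the reservoir means [a] and [B] at indices 0 and [n.+1],
    around the site means. Past its end [nth] returns the constant 0, hence the case analysis. *)
Lemma measurable_nth_cons_rcons n (a : R) i :
  measurable_fun setT (fun t : n.-tuple RT => nth 0 (a :: rcons t B) i : RT).
Proof.
case: i => [|i] /=; first exact: measurable_cst.
have [lt_in|] := ltnP i n.
  rewrite (_ : (fun _ => _) = (@tnth n RT)^~ (Ordinal lt_in)).
    exact: measurable_tnth.
  by apply/funext => t; rewrite nth_rcons size_tuple lt_in (tnth_nth 0).
rewrite leq_eqVlt => /predU1P[<-|lt_ni].
  rewrite (_ : (fun _ => _) = cst (B : RT)); first exact: measurable_cst.
  by apply/funext => t; rewrite nth_rcons size_tuple ltnn eqxx.
rewrite (_ : (fun _ => _) = cst (0 : RT)); first exact: measurable_cst.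
by apply/funext => t; rewrite nth_default// size_rcons size_tuple.
Qed.

Lemma measurable_ordered_means n (a : R) :
  measurable (ordered_means a B : set (n.-tuple RT)).
Proof.
rewrite (_ : ordered_means a B = \bigcap_(i in `I_n.+1)
    [set t : n.-tuple RT |
      nth 0 (a :: rcons t B) i <= nth 0 (a :: rcons t B) i.+1]).
  apply: bigcap_measurableType => i _.
  rewrite -[X in measurable X]setTI.
  by apply: measurable_fun_le => //; exact: measurable_nth_cons_rcons.
apply/seteqP; split => t.
  by move=> /(pathP 0) H i /= ?; apply: H; rewrite size_rcons size_tuple.
move=> H; apply/(pathP 0) => i; rewrite size_rcons size_tuple => ?.
exact: H.
Qed.

Lemma ge0_integral_lebesgue_tupleS n (f : n.+1.-tuple RT -> \bar R) :
  measurable_fun [set: n.+1.-tuple RT] f -> (forall t, 0 <= f t)%E ->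
  (\int[lebesgue_tuple n.+1]_t f t =
   \int[(@lebesgue_measure R \x lebesgue_tuple n)]_p f (tuple_cons p))%E.
Proof.
move=> mf f0; rewrite /= /lebesgue_cons.
by rewrite (ge0_integral_pushforward (@measurable_tuple_cons R n)).
Qed.

Section cons.
Variables (n : nat) (a : R) (f : n.+1.-tuple RT -> \bar R).
Let D : set (n.+1.-tuple RT) := ordered_means a B.
Hypotheses (mf : measurable_fun [set: n.+1.-tuple RT] f).
Hypotheses (f0 : forall t, D t -> (0 <= f t)%E).

Let mfD : measurable_fun setT (f \_ D).
Proof.
apply/(measurable_restrictT _ _).1; first exact: measurable_ordered_means.
exact: measurable_funTS.
Qed.

Let fD0 t : (0 <= (f \_ D) t)%E.
Proof. by apply: erestrict_ge0. Qed.

Let mfDc : measurable_fun setT (f \_ D \o @tuple_cons R n).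
Proof. exact: measurableT_comp mfD (@measurable_tuple_cons R n). Qed.

(** Tonelli with the first mean integrated last: once it equals [x], the other means range over the
    simplex with lower end [x]. This is the form that suits an induction on the number of sites. *)
Lemma integral_ordered_means_outer :
  (\int[lebesgue_tuple n.+1]_(t in D) f t =
   \int[lebesgue_measure]_(x in `[a, B])
     \int[lebesgue_tuple n]_(t in ordered_means x B) f (tuple_cons (x, t)))%E.
Proof.
rewrite integral_mkcond ge0_integral_lebesgue_tupleS//.
rewrite (fubini_tonelli1 (f \_ D \o @tuple_cons R n))//; last first.
  by move=> x; exact: fD0.
rewrite [RHS]integral_mkcond; apply: eq_integral => x _.
rewrite /fubini_F patchE; case: ifPn => [|] xaB.
  rewrite [RHS]integral_mkcond; apply: eq_integral => t _ /=.
  rewrite !patchE; congr (if _ then _ else _).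
  apply/idP/idP; rewrite !inE => /=.
    by move/ordered_means_cons => [].
  move=> xt; apply/ordered_means_cons; split=> //.
  by move: xaB; rewrite inE/= in_itv/= => /andP[].
(* A nonempty slice forces [a <= x] and, by following the chain up to its end, [x <= B]. *)
apply: integral0_eq => t _ /=; rewrite patchE ifF//.
apply/negbTE; apply: contra xaB; rewrite !inE => /ordered_means_cons.
move=> [ax /ordered_means_le xB].
by rewrite /= in_itv/= ax.
Qed.

(** Tonelli in the opposite order: with the later means frozen, the first one runs from [a] to its
    successor. The default value in [head B t] is the right reservoir mean, which covers the case of
    a single site. *)
Lemma integral_ordered_means_inner :
  (\int[lebesgue_tuple n.+1]_(t in D) f t =
   \int[lebesgue_tuple n]_(t in ordered_means a B)
     \int[lebesgue_measure]_(x in `[a, head B t]) f (tuple_cons (x, t)))%E.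
Proof.
rewrite integral_mkcond ge0_integral_lebesgue_tupleS//.
rewrite (fubini_tonelli2 (f \_ D \o @tuple_cons R n))//; last first.
  by move=> x; exact: fD0.
rewrite [RHS]integral_mkcond; apply: eq_integral => t _.
have DE x : D (tuple_cons (x, t)) <->
    `[a, head B t]%classic x /\ ordered_means a B t.
  rewrite /D ordered_means_cons /= in_itv /= /ordered_means /=.
  case: t => -[|y t] /= _; rewrite ?andbT.
    split=> [[ax xB]|[/andP[ax xB] aB]]//.
    by split; [rewrite ax|exact: le_trans xB].
  split=> [[ax /andP[xy ->]]|[/andP[ax xy] /andP[ay ->]]]; rewrite ?ax ?xy//.
  by rewrite (le_trans ax xy).
rewrite /fubini_G patchE; case: ifPn => [|] ta.
  rewrite [RHS]integral_mkcond; apply: eq_integral => x _ /=.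
  rewrite !patchE; congr (if _ then _ else _).
  apply/idP/idP; rewrite !inE => /=; first by move/DE => [].
  by move=> ?; apply/DE; split => //; move: ta; rewrite inE.
apply: integral0_eq => x _ /=; rewrite patchE ifF//.
by apply/negbTE; apply: contra ta; rewrite !inE => /DE[].
Qed.

End cons.
End ordered_integrals.

(** * The one-site identity *)

Section one_site.
Context {R : realType}.
Local Notation RT := (measurableTypeR R).

Definition fugacity (m : R) : R := m / (1 + m).

Definition geo (k : nat) (m : R) : R := 1 / (1 + m) * fugacity m ^+ k.

Definition hsum (k : nat) (t : R) : R := \sum_(1 <= i < k.+1) t ^+ i / i%:R.

Implicit Types (a b c m x : R) (n k : nat).

Lemma integral_is_derive (F f : R -> R) a b : a <= b ->
  (forall x, a <= x <= b -> is_derive x 1 F (f x)) ->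
  (forall x, a <= x <= b -> {for x, continuous f}) ->
  (\int[lebesgue_measure]_(x in `[a, b]) (f x)%:E = (F b - F a)%:E)%E.
Proof.
rewrite le_eqVlt => /predU1P[<- _ _|ab dF cf].
  by rewrite set_itv1 integral_set1 subrr.
have cF x : a <= x <= b -> {for x, continuous F}.
  move=> /dF dFx; apply: differentiable_continuous.
  by apply/derivable1_diffP; exact: ex_derive.
rewrite (@continuous_FTC2 _ f F)//.
- apply: continuous_in_subspaceT => x; rewrite inE/= in_itv/=; exact: cf.
- split=> [x||].
  + by rewrite in_itv/= => /andP[/ltW ax /ltW xb]; have := dF x; rewrite ax xb => /(_ isT) [].
  + by apply: cvg_at_right_filter; apply: cF; rewrite lexx ltW.
  + by apply: cvg_at_left_filter; apply: cF; rewrite lexx ltW.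
- move=> x; rewrite in_itv/= => /andP[/ltW ax /ltW xb].
  by have := dF x; rewrite ax xb derive1E => /(_ isT) [].
Qed.

Lemma is_derive_sumE n (h : 'I_n -> R -> R) (x : R) (dh : 'I_n -> R) :
  (forall i, is_derive x 1 (h i) (dh i)) ->
  is_derive x 1 (fun y => \sum_(i < n) h i y) (\sum_(i < n) dh i).
Proof.
move=> H; rewrite (_ : (fun _ => _) = \sum_(i < n) h i).
  exact: is_derive_sum.
by apply/funext => y; rewrite fct_sumE.
Qed.

Lemma continuous_sumE (I : Type) (r : seq I) (h : I -> R -> R) (x : R) :
  (forall i, {for x, continuous (h i)}) ->
  {for x, continuous (fun y => \sum_(i <- r) h i y)}.
Proof.
move=> hx; elim: r => [|i r IH].
  rewrite (_ : (fun _ => _) = cst 0); first exact: cst_continuous.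
  by apply/funext => y; rewrite big_nil.
rewrite (_ : (fun _ => _) = (fun y => h i y + \sum_(j <- r) h j y)).
  by apply: cvgD; [exact: hx|exact: IH].
by apply/funext => y; rewrite big_cons.
Qed.

(* If [s] is symmetric, then so is [S x y := \sum_ij s i j f_i(x) f_j(y)], and
   the integrand is the derivative of [S(., a) + S(., b)] minus that of the
   diagonal [S(x, x)]. *)
Lemma integral_symmetric_form n (s : 'I_n -> 'I_n -> R) (f f' : 'I_n -> R -> R)
    a b : a <= b -> (forall i j, s i j = s j i) ->
  (forall i x, a <= x <= b -> is_derive x 1 (f i) (f' i x)) ->
  (forall i x, a <= x <= b -> {for x, continuous (f' i)}) ->
  (\int[lebesgue_measure]_(x in `[a, b])
     (\sum_i \sum_j s i j * (f' i x * (f j a + f j b - 2 * f j x)))%:E = 0)%E.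
Proof.
move=> ab sC df cf'.
pose F x := \sum_i \sum_j s i j * (f i x * (f j a + f j b - f j x)).
pose g x := \sum_i \sum_j s i j * (f' i x * (f j a + f j b - 2 * f j x)).
suff [dF cg] : (forall x, a <= x <= b -> is_derive x 1 F (g x)) /\
    (forall x, a <= x <= b -> {for x, continuous g}).
  rewrite (integral_is_derive ab dF cg).
  rewrite (_ : F b - F a = 0)//.
  (* [E] is the symmetry S(x, y) = S(y, x). At each end the subtracted diagonal cancels one of the
     two other terms, leaving F(b) = S(b, a) and F(a) = S(a, b). *)
  have E x y : \sum_i \sum_j s i j * (f i x * f j y) =
               \sum_i \sum_j s i j * (f i y * f j x).
    rewrite exchange_big; apply: eq_bigr => j _; apply: eq_bigr => i _.
    by rewrite sC mulrCA [_ * f i x]mulrC mulrCA.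
  have Fb : F b = \sum_i \sum_j s i j * (f i b * f j a).
    by apply: eq_bigr => i _; apply: eq_bigr => j _; rewrite addrK.
  have Fa : F a = \sum_i \sum_j s i j * (f i a * f j b).
    by apply: eq_bigr => i _; apply: eq_bigr => j _; rewrite addrAC subrr add0r.
  by rewrite Fb Fa E subrr.
split.
- move=> x xab.
  have dF : is_derive x 1 F (\sum_i \sum_j s i j *
      (f' i x * (f j a + f j b - f j x) - f i x * f' j x)).
    apply: is_derive_sumE => i; apply: is_derive_sumE => j.
    have dfi := df i x xab; have dfj := df j x xab.
    have -> : (fun y => s i j * (f i y * (f j a + f j b - f j y))) =
      s i j *: (f i * (cst (f j a + f j b) - f j)) by [].
    apply: is_derive_eq; rewrite sub0r /GRing.scale/=.
    by rewrite /cst !fctE; ring.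
  apply: (is_derive_eq dF).
  have sum2B (u v : 'I_n -> 'I_n -> R) : \sum_i \sum_j (u i j - v i j) =
      \sum_i \sum_j u i j - \sum_i \sum_j v i j.
    by rewrite -sumrB; apply: eq_bigr => i _; rewrite -sumrB.
  transitivity (\sum_i \sum_j s i j * (f' i x * (f j a + f j b - f j x)) -
      \sum_i \sum_j s i j * (f i x * f' j x)).
    rewrite -sum2B; apply: eq_bigr => i _; apply: eq_bigr => j _.
    by rewrite mulrBr.
  (* By symmetry of [s], the two halves of the derivative of the diagonal coincide; this is the
     factor 2 in [g]. *)
  transitivity (\sum_i \sum_j s i j * (f' i x * (f j a + f j b - f j x)) -
      \sum_i \sum_j s i j * (f' i x * f j x)).
    congr (_ - _); rewrite exchange_big; apply: eq_bigr => j _.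
    by apply: eq_bigr => i _; rewrite sC [f i x * _]mulrC.
  rewrite -sum2B; apply: eq_bigr => i _; apply: eq_bigr => j _; ring.
- move=> x xab.
  apply: continuous_sumE => i; apply: continuous_sumE => j.
  apply: cvgM; first exact: cvg_cst.
  apply: cvgM; first exact: cf'.
  apply: cvgB; first exact: cvg_cst.
  apply: cvgM; first exact: cvg_cst.
  apply: differentiable_continuous.
  by apply/derivable1_diffP; have [] := df j x xab.
Qed.

Lemma hsumE k (t : R) : hsum k t = \sum_(i < k) t ^+ i.+1 / i.+1%:R.
Proof. by rewrite /hsum big_add1 big_mkord. Qed.

Lemma fugacityC m : 0 < m -> 1 - fugacity m = (1 + m)^-1.
Proof. by move=> m0; rewrite /fugacity; field; lra. Qed.

Lemma fugacity_gt0 m : 0 < m -> 0 < fugacity m.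
Proof. by move=> m0; rewrite divr_gt0//; lra. Qed.

(* [\sum_ij site_coef k i j * site_fun i m * site_fun j c] is S m c. *)
Definition site_fun (i : nat) (m : R) : R :=
  if i == 0 then ln (1 + m) else fugacity m ^+ i / i%:R.

Definition site_fun' (i : nat) (m : R) : R :=
  if i == 0 then (1 + m)^-1 else fugacity m ^+ i.-1 * (1 + m) ^- 2.

Definition site_coef n (i j : nat) : R :=
  if (i == 0) && (j == 0) then -1
  else if (i == 0) || (j == 0) then 1 else - (i + j <= n)%N%:R.

(** Write q for [fugacity m]. As 1 - q = 1 / (1 + m), the sums over [i] are geometric and telescope.
    The coefficient of [ln (1 + c)] becomes (-1 + (1 - q^n)) / (1 + m), and that of the j-th power
    of [fugacity c], divided by j, becomes (1 - (1 - q^(n-j))) / (1 + m); both are multiples of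
    [geo n m]. *)
Lemma site_coefE n m c : 0 < m ->
  \sum_(i < n.+1) \sum_(j < n.+1) site_coef n i j * (site_fun' i m * site_fun j c) =
  geo n m * (hsum n (fugacity c / fugacity m) - ln (1 + c)).
Proof.
move=> m0; have q0 := fugacity_gt0 m0.
have rE := fugacityC m0.
rewrite big_ord_recl [X in X + _]big_ord_recl.
rewrite /site_coef /site_fun /site_fun' /=.
under [X in _ + X = _]eq_bigr do rewrite big_ord_recl /=.
rewrite big_split /= /geo hsumE.
have geomr k : (\sum_(i < k) fugacity m ^+ i) * (1 + m)^-1 = 1 - fugacity m ^+ k.
  by rewrite -rE -[RHS]opprB subrX1; ring.
have -> : \sum_(i < n) 1 * (fugacity m ^+ i / (1 + m) ^+ 2 * ln (1 + c)) =
    (1 - fugacity m ^+ n) * (1 + m)^-1 * ln (1 + c).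
  rewrite -geomr !mulr_suml; apply: eq_bigr => i _.
  by rewrite mul1r; field; lra.
rewrite exchange_big /= addrACA.
have -> : -1 * ((1 + m)^-1 * ln (1 + c)) + (1 - fugacity m ^+ n) / (1 + m) * ln (1 + c) =
   - (fugacity m ^+ n) / (1 + m) * ln (1 + c) by ring.
rewrite -big_split /= mulrBr addrC; congr (_ + _); last by ring.
rewrite mulr_sumr; apply: eq_bigr => j _.
set y := fugacity c ^+ bump 0 j / _.
(* Both indices are shifted by one through [bump 0], so the constraint of [site_coef] keeps exactly
   the indices [i < n - j.+1]. *)
have -> : \sum_(i < n) - (bump 0 i + bump 0 j <= n)%N%:R *
    (fugacity m ^+ (0 + i) / (1 + m) ^+ 2 * y) =
    - (1 - fugacity m ^+ (n - j.+1)) * (1 + m)^-1 * y.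
  have le_nj : (n - j.+1 <= n)%N by rewrite leq_subr.
  rewrite -geomr (big_ord_widen _ (fun i => fugacity m ^+ i) le_nj).
  rewrite -mulNr -sumrN !mulr_suml [RHS]big_mkcond/=; apply: eq_bigr => i _.
  have -> : (bump 0 i + bump 0 j <= n)%N = (i < n - j.+1)%N.
    by rewrite /bump/=; lia.
  rewrite add0n; case: ifP => _; rewrite ?oppr0 ?mul0r//=.
  by field; lra.
rewrite /y /bump add1n (expr_div_n (fugacity c)).
move: (fugacity c ^+ j.+1) => w.
have -> : fugacity m ^+ n = fugacity m ^+ (n - j.+1) * fugacity m ^+ j.+1.
  by rewrite -exprD subnK.
have : fugacity m ^+ j.+1 != 0 by rewrite expf_neq0// gt_eqF.
move: (fugacity m ^+ _) (fugacity m ^+ _) => u v v0.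
have j0 : j.+1%:R != 0 :> R by rewrite pnatr_eq0.
move: (j.+1%:R) j0 => d d0.
by field; rewrite v0 d0/=; lra.
Qed.

Lemma is_derive_addl (c x : R) : is_derive x 1 (fun y : R => c + y) 1.
Proof.
have := is_deriveD (is_derive_cst c x 1) (is_derive_id x 1).
by rewrite add0r.
Qed.

Lemma is_derive_fugacity x : 0 <= x -> is_derive x 1 fugacity ((1 + x) ^- 2).
Proof.
move=> x0; have x1 : 1 + x != 0 by lra.
have dV := is_deriveV x1 (is_derive_addl 1 x).
rewrite (_ : fugacity = id * (fun y : R => (1 + y)^-1))//.
by apply: is_derive_eq; rewrite /GRing.scale/=; field.
Qed.

Lemma is_derive_site_fun i x : 0 <= x -> is_derive x 1 (site_fun i) (site_fun' i x).
Proof.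
move=> x0; have x1 : 0 < 1 + x by lra.
rewrite /site_fun /site_fun'; case: eqP => [_|/eqP i0].
  have := is_derive1_comp (g := fun y => 1 + y) (is_derive1_ln x1) (is_derive_addl 1 x).
  by rewrite mulr1.
have df := is_derive_fugacity x0.
rewrite (_ : (fun m => _) = i%:R^-1 *: fugacity ^+ i); last first.
  by apply/funext => y; rewrite mulrC exprfctE.
apply: is_derive_eq; rewrite /GRing.scale/= !mulrA mulVf ?mul1r//.
by rewrite pnatr_eq0.
Qed.

Lemma continuous_geo i x : 0 < x -> {for x, continuous (geo i)}.
Proof.
move=> x0; have x1 : 1 + x != 0 by lra.
apply: cvgM.
  apply: cvgM; first exact: cvg_cst.
  apply: cvgV => //; apply: cvgD; [exact: cvg_cst|exact: cvg_id].
apply: (@continuous_comp _ _ _ fugacity (fun y => y ^+ i)); last exact: exprn_continuous.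
apply: differentiable_continuous.
by apply/derivable1_diffP; have [] := is_derive_fugacity (ltW x0).
Qed.

Lemma continuous_site_fun' i x : 0 < x -> {for x, continuous (site_fun' i)}.
Proof.
move=> x0; have x1 : 1 + x != 0 by lra.
have cV : {for x, continuous (fun y : R => (1 + y)^-1)}.
  by apply: cvgV => //; apply: cvgD; [exact: cvg_cst|exact: cvg_id].
have c2 : {for x, continuous (fun y : R => (1 + y) ^- 2)}.
  rewrite (_ : (fun y : R => _) = (fun y => (1 + y)^-1 * (1 + y)^-1)).
    exact: (continuousM cV cV).
  by apply/funext => y; rewrite -exprVn expr2.
rewrite /site_fun'; case: eqP => // _.
apply: cvgM.
  apply: (@continuous_comp _ _ _ fugacity (fun y => y ^+ i.-1)); last exact: exprn_continuous.
  apply: differentiable_continuous.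
  by apply/derivable1_diffP; have [] := is_derive_fugacity (ltW x0).
exact: c2.
Qed.

Lemma hsum_ge0 k (t : R) : 0 <= t -> 0 <= hsum k t.
Proof. by move=> t0; apply: sumr_ge0 => i _; rewrite divr_ge0// exprn_ge0. Qed.

Lemma geo_ge0 k m : 0 < m -> 0 <= geo k m.
Proof.
move=> m0; rewrite mulr_ge0 ?exprn_ge0 ?(ltW (fugacity_gt0 m0))//.
by rewrite divr_ge0//; lra.
Qed.

(** The positive terms of the one-site integrand; [site_loss] collects the negative ones. With both
    sides nonnegative, Tonelli applies on the simplex without any integrability condition. *)
Definition site_gain k a m c : R :=
  hsum k (fugacity a / fugacity m) + hsum k (fugacity c / fugacity m) +
  2 * ln (1 + m).

Definition site_loss k a c : R := 2 * hsum k 1 + ln (1 + a) + ln (1 + c).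

Lemma fugacity_ge0 x : 0 <= x -> 0 <= fugacity x.
Proof. by move=> x0; rewrite divr_ge0//; lra. Qed.

Lemma fugacity_lt1 x : 0 <= x -> fugacity x < 1.
Proof. by move=> x0; rewrite /fugacity ltr_pdivrMr; lra. Qed.

Lemma ler_fugacity x y : 0 <= x -> x <= y -> fugacity x <= fugacity y.
Proof.
move=> x0 xy; rewrite /fugacity ler_pdivrMr; last lra.
by rewrite mulrAC ler_pdivlMr; nra.
Qed.

Lemma geo_le1 k x : 0 < x -> geo k x <= 1.
Proof.
move=> x0; rewrite /geo -[leRHS]mulr1 ler_pM//.
- by rewrite divr_ge0//; lra.
- by rewrite exprn_ge0// fugacity_ge0// ltW.
- by rewrite ler_pdivrMr; lra.
- by rewrite exprn_ile1// ?fugacity_ge0 ?ltW// fugacity_lt1// ltW.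
Qed.

(* The difference vanishes at 0 and has derivative [geo n]. *)
Lemma ln1D_hsum n m : 0 < m ->
  0 <= ln (1 + m) - hsum n (fugacity m) <= m * fugacity m ^+ n.
Proof.
(* [D] is the difference written with [site_fun], whose derivatives are known: index 0 is the
   logarithm, and the sign is -1 at the other indices. *)
move=> m0; pose D x := \sum_(i < n.+1) (-1) ^+ (i != 0%N :> nat) * site_fun i x.
have DE x : D x = ln (1 + x) - hsum n (fugacity x).
  rewrite /D big_ord_recl/= expr0 mul1r hsumE; congr (_ + _).
  by rewrite -sumrN; apply: eq_bigr => i _; rewrite expr1 mulN1r.
have dD x : 0 <= x -> is_derive x 1 D (geo n x).
  move=> x0.
  have dDx : is_derive x 1 D
      (\sum_(i < n.+1) (-1) ^+ (i != 0%N :> nat) * site_fun' i x).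
    apply: is_derive_sumE => i; have df := is_derive_site_fun i x0.
    rewrite (_ : (fun y => _) = (-1) ^+ (i != 0%N :> nat) *: site_fun i)//.
    by apply: is_derive_eq.
  apply: (is_derive_eq dDx); rewrite big_ord_recl /= expr0 mul1r.
  have rE : 1 - fugacity x = (1 + x)^-1 by rewrite /fugacity; field; lra.
  transitivity ((1 + x)^-1 - (\sum_(i < n) fugacity x ^+ i) * (1 + x) ^- 2).
    congr (_ + _); rewrite mulr_suml -sumrN; apply: eq_bigr => i _.
    by rewrite /site_fun'/= expr1 mulN1r add0n.
  have := subrX1 (fugacity x) n; rewrite -(opprB 1 (fugacity x)) rE => H.
  have {H} -> : (\sum_(i < n) fugacity x ^+ i) * (1 + x) ^- 2 =
      (1 - fugacity x ^+ n) * (1 + x)^-1.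
    by rewrite -[1 - _ ^+ n]opprB H; field; lra.
  by rewrite /geo; field; lra.
have cD : {within `[0, m], continuous D}.
  apply: derivable_within_continuous => x; rewrite in_itv/= => /andP[/dD dDx _].
  by have [] := dDx.
(* Mean value theorem: the intermediate point satisfies [geo n c <= fugacity c ^+ n <= fugacity m ^+
   n]. *)
have [x] : exists2 c, c \in `]0, m[%R & D m - D 0 = geo n c * (m - 0).
  apply: MVT => // x; rewrite in_itv/= => /andP[/ltW/dD].
  by [].
rewrite in_itv/= => /andP[x0 xm]; rewrite !DE addr0 ln1 sub0r.
have -> : hsum n (fugacity 0) = 0.
  by rewrite /fugacity mul0r hsumE big1// => i _; rewrite expr0n/= mul0r.
rewrite !oppr0 !addr0 => ->.
apply/andP; split; first by apply: mulr_ge0; [exact: geo_ge0|exact: ltW].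
rewrite mulrC ler_wpM2l ?(ltW m0)//.
rewrite /geo -[leRHS]mul1r ler_pM ?exprn_ge0 ?fugacity_ge0 ?(ltW x0)//.
- by rewrite divr_ge0//; lra.
- by rewrite ler_pdivrMr; lra.
- rewrite lerXn2r ?nnegrE ?fugacity_ge0 ?ler_fugacity ?(ltW x0) ?(ltW xm)//.
  exact: ltW.
Qed.

(** This is the series of - ln (1 - q) at q = [fugacity m], where 1 - q = 1 / (1 + m). The term
    [k = 0] vanishes because division by 0 yields 0. Convergence follows by squeezing with the
    remainder bound of [ln1D_hsum]. *)
Lemma nneseries_ln1D m : 0 < m ->
  (\sum_(0 <= k <oo) (fugacity m ^+ k / k%:R)%:E = (ln (1 + m))%:E)%E.
Proof.
move=> m0; apply/cvg_lim => //.
rewrite -(cvg_shiftS (fun n => \sum_(0 <= k < n) _)%E) /=.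
rewrite (_ : (fun n => _) = EFin \o (fun n => hsum n (fugacity m))); last first.
  apply/funext => n /=; rewrite sumEFin big_nat_recl//= invr0 mulr0 add0r.
  by rewrite /hsum big_add1.
apply: cvg_EFin; first exact: nearW.
rewrite -[in X in _ --> X](subr0 (ln (1 + m))).
have q0 := fugacity_gt0 m0.
apply: (@squeeze_cvgr _ _ _ _ (fun n => ln (1 + m) - m * fugacity m ^+ n) (cst (ln (1 + m)))).
- near=> n; have /andP[h1 h2] := ln1D_hsum n m0.
  by rewrite /cst/=; apply/andP; split; lra.
- apply: cvgB; first exact: cvg_cst.
  apply: cvg_geometric; rewrite gtr0_norm// fugacity_lt1// ltW//.
- rewrite subr0; exact: cvg_cst.
Unshelve. all: by end_near. Qed.

Lemma ln1D_ge0 m : 0 < m -> 0 <= ln (1 + m).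
Proof. by move=> m0; rewrite ln_ge0// lerDl ltW. Qed.

Lemma site_gain_ge0 k a m c : 0 < a -> 0 < m -> 0 < c -> 0 <= site_gain k a m c.
Proof.
move=> a0 m0 c0; rewrite !addr_ge0 ?mulr_ge0 ?ln1D_ge0 ?hsum_ge0//;
  by rewrite divr_ge0// ltW// fugacity_gt0.
Qed.

Lemma site_loss_ge0 k a c : 0 < a -> 0 < c -> 0 <= site_loss k a c.
Proof. by move=> a0 c0; rewrite !addr_ge0 ?mulr_ge0 ?ln1D_ge0 ?hsum_ge0. Qed.

(** By [site_coefE], used with [a], with [c] and, with factor -2, with the variable itself, the
    difference of the two integrands is the form [g] whose integral vanishes by
    [integral_symmetric_form]. The diagonal use produces the term [hsum k 1]. *)
Lemma integral_one_site k a c : 0 < a -> a <= c ->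
  (\int[lebesgue_measure]_(m in `[a, c]) (geo k m * site_gain k a m c)%:E =
   \int[lebesgue_measure]_(m in `[a, c]) (geo k m * site_loss k a c)%:E)%E.
Proof.
move=> a0 ac.
have pos x : a <= x <= c -> 0 < x by move=> /andP[ax _]; exact: lt_le_trans ax.
pose g x := \sum_(i < k.+1) \sum_(j < k.+1)
  site_coef k i j * (site_fun' i x * (site_fun j a + site_fun j c - 2 * site_fun j x)).
have gE x : a <= x <= c -> geo k x * site_gain k a x c = g x + geo k x * site_loss k a c.
  move=> /pos x0; rewrite /g.
  transitivity (
    \sum_(i < k.+1) \sum_(j < k.+1) site_coef k i j * (site_fun' i x * site_fun j a)
    + \sum_(i < k.+1) \sum_(j < k.+1) site_coef k i j * (site_fun' i x * site_fun j c)
    + -2 * (\sum_(i < k.+1) \sum_(j < k.+1) site_coef k i j * (site_fun' i x * site_fun j x))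
    + geo k x * site_loss k a c).
    rewrite !site_coefE// divff ?gt_eqF ?fugacity_gt0//.
    by rewrite /site_gain /site_loss; ring.
  congr (_ + _); rewrite mulr_sumr -!big_split; apply: eq_bigr => i _ /=.
  rewrite mulr_sumr -!big_split; apply: eq_bigr => j _ /=; ring.
have g0 : (\int[lebesgue_measure]_(m in `[a, c]) (g m)%:E = 0)%E.
  apply: (@integral_symmetric_form _ (site_coef k) site_fun site_fun') => //.
  - by move=> i j; rewrite /site_coef andbC orbC addnC.
  - by move=> i x /pos/ltW; exact: is_derive_site_fun.
  - by move=> i x /pos; exact: continuous_site_fun'.
have cint (h : R -> R) : (forall x, a <= x <= c -> {for x, continuous h}) ->
    lebesgue_measure.-integrable `[a, c] (EFin \o h).
  move=> ch; apply: continuous_compact_integrable; first exact: segment_compact.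
  by apply: continuous_in_subspaceT => x; rewrite inE/= in_itv/=; exact: ch.
under eq_integral => x.
  rewrite inE/= in_itv/= => xac; rewrite (gE _ xac) EFinD; over.
rewrite integralD//; first by rewrite g0 add0e.
- apply: cint => x xac.
  apply: continuous_sumE => i; apply: continuous_sumE => j.
  apply: cvgM; first exact: cvg_cst.
  apply: cvgM; first by apply: continuous_site_fun'; exact: pos.
  apply: cvgB; first exact: cvg_cst.
  apply: cvgM; first exact: cvg_cst.
  apply: differentiable_continuous; apply/derivable1_diffP.
  by have [] := is_derive_site_fun j (ltW (pos _ xac)).
- apply: cint => x xac; apply: cvgM; last exact: cvg_cst.
  by apply: continuous_geo; exact: pos.
Qed.

End one_site.

(** * Measurability of the one-site functions and of the geometric product *)

Section measurability.
Context {R : realType}.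
Local Notation RT := (measurableTypeR R).

(** Inversion is continuous only away from 0, so the line is cut into the point 0 and its open
    complement. *)
Lemma measurable_invr : measurable_fun [set: RT] (fun x : RT => x^-1 : RT).
Proof.
rewrite -(setUv [set (0 : R)]).
have m0 : measurable [set (0 : R)] by exact: measurable_set1.
apply/measurable_funU => //; first exact: measurableC.
split; first exact: measurable_fun_set1.
apply: open_continuous_measurable_fun; first exact: closed_openC.
by move=> x; rewrite inE/= => /eqP x0; exact: inv_continuous.
Qed.

Lemma measurable_fugacity : measurable_fun [set: RT] (fugacity : RT -> RT).
Proof.
apply: measurable_funM; first exact: measurable_id.
apply: (measurableT_comp measurable_invr).
by apply: measurable_funD; [exact: measurable_cst|exact: measurable_id].
Qed.

Lemma measurable_geo k : measurable_fun [set: RT] (geo k : RT -> RT).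
Proof.
apply: measurable_funM; last by apply: measurable_funX; exact: measurable_fugacity.
apply: measurable_funM; first exact: measurable_cst.
apply: (measurableT_comp measurable_invr).
by apply: measurable_funD; [exact: measurable_cst|exact: measurable_id].
Qed.

Lemma measurable_hsum k : measurable_fun [set: RT] (hsum k : RT -> RT).
Proof.
apply: measurable_sum => i; apply: measurable_funM; last exact: measurable_cst.
by apply: measurable_funX; exact: measurable_id.
Qed.

Lemma measurable_ln1D : measurable_fun [set: RT] (fun m : RT => ln (1 + m) : RT).
Proof.
apply: (measurableT_comp (@measurable_ln R)).
by apply: measurable_funD; [exact: measurable_cst|exact: measurable_id].
Qed.

Section with_functions.
Context d (T : measurableType d).
Implicit Types f g h : T -> RT.

Lemma measurable_site_gain k f g h :
  measurable_fun setT f -> measurable_fun setT g -> measurable_fun setT h ->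
  measurable_fun setT (fun t => site_gain k (f t) (g t) (h t) : RT).
Proof.
move=> mf mg mh.
have mq f1 g1 : measurable_fun setT f1 -> measurable_fun setT g1 ->
    measurable_fun setT (fun t : T => hsum k (fugacity (f1 t) / fugacity (g1 t)) : RT).
  move=> mf1 mg1; apply: (measurableT_comp (@measurable_hsum k)).
  apply: measurable_funM; first exact: (measurableT_comp measurable_fugacity).
  apply: (measurableT_comp measurable_invr).
  exact: (measurableT_comp measurable_fugacity).
apply: measurable_funD.
  by apply: measurable_funD; exact: mq.
apply: measurable_funM; first exact: measurable_cst.
exact: (measurableT_comp measurable_ln1D).
Qed.

Lemma measurable_site_loss k f h :
  measurable_fun setT f -> measurable_fun setT h ->
  measurable_fun setT (fun t => site_loss k (f t) (h t) : RT).
Proof.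
move=> mf mh; apply: measurable_funD; last exact: (measurableT_comp measurable_ln1D).
apply: measurable_funD; last exact: (measurableT_comp measurable_ln1D).
exact: measurable_cst.
Qed.

End with_functions.

Lemma geometric_productE N (m : N.-tuple RT) (eta : config N) :
  geometric_product m eta = \prod_(x < N) geo (tnth eta x) (tnth m x).
Proof. by []. Qed.

Lemma measurable_geometric_product N (eta : config N) :
  measurable_fun [set: N.-tuple RT]
    (fun m : N.-tuple RT => geometric_product m eta : RT).
Proof.
apply: measurable_prod => x _.
exact: (measurableT_comp (@measurable_geo _) (@measurable_tnth _ _ _ _)).
Qed.

Lemma geometric_product_cons N x (m : N.-tuple RT) (eta : config N.+1) :
  geometric_product (tuple_cons (x, m)) eta =
  geo (thead eta) x * geometric_product m [tuple of behead eta].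
Proof.
case/tupleP: eta => k t; rewrite !geometric_productE big_ord_recl theadE.
have -> : [tuple of behead (k :: t)] = t by exact/val_inj.
by congr (_ * _); apply: eq_bigr => i _; rewrite /tuple_cons !tnthS.
Qed.

End measurability.

(** * The site identities on the simplex *)

Section sites.
Context {R : realType}.
Local Notation RT := (measurableTypeR R).
Variable B : R.

Lemma ordered_means_nth_ge n a (t : n.-tuple RT) i : ordered_means a B t ->
  (i <= n.+1)%N -> a <= nth 0 (a :: rcons t B) i.
Proof.
move=> /(order_path_min le_trans)/allP at_; case: i => [|i]//= i_n.
by apply: at_; rewrite mem_nth// size_rcons size_tuple.
Qed.

Lemma geometric_product_ge0 n a (t : n.-tuple RT) (eta : config n) : 0 < a ->
  ordered_means a B t -> 0 <= geometric_product t eta.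
Proof.
move=> a0 aOt; rewrite geometric_productE; apply: prodr_ge0 => x _; apply: geo_ge0.
apply: lt_le_trans a0 _.
have := ordered_means_nth_ge (i := x.+1) aOt.
by rewrite /= nth_rcons size_tuple ltn_ord -tnth_nth ltnS ltnW//; apply.
Qed.

(** Index [y] is the site whose mean is [s t y.+1], between its neighbours [s t y] and [s t y.+2].
    The means before it are peeled off one at a time as outer variables, each becoming the new lower
    end, until the site is the first one; its mean is then made the innermost variable and
    [integral_one_site] applies. *)
Lemma integral_site n a (eta : config n) y : 0 < a -> (y < n)%N ->
  let s (t : n.-tuple RT) := nth 0 (a :: rcons t B) in
  (\int[lebesgue_tuple n]_(t in ordered_means a B)
     (geometric_product t eta *
        site_gain (nth 0%N eta y) (s t y) (s t y.+1) (s t y.+2))%:E =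
   \int[lebesgue_tuple n]_(t in ordered_means a B)
     (geometric_product t eta * site_loss (nth 0%N eta y) (s t y) (s t y.+2))%:E)%E.
Proof.
have headE (s : seq R) : head 0 (rcons s B) = head B s by case: s.
move=> + + s; rewrite {}/s; elim: n a eta y => // n IH a eta y a0 yn.
have pos (t : n.+1.-tuple RT) i : ordered_means a B t -> (i <= n.+2)%N ->
    0 < nth 0 (a :: rcons t B) i.
  by move=> aOt i_n; apply: lt_le_trans a0 _; exact: ordered_means_nth_ge.
have mL : measurable_fun [set: n.+1.-tuple RT] (fun t : n.+1.-tuple RT =>
    (geometric_product t eta * site_gain (nth 0%N eta y)
      (nth 0 (a :: rcons t B) y) (nth 0 (a :: rcons t B) y.+1)
      (nth 0 (a :: rcons t B) y.+2))%:E).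
  apply/measurable_EFinP/measurable_funM; first exact: measurable_geometric_product.
  by apply: measurable_site_gain; exact: measurable_nth_cons_rcons.
have mR : measurable_fun [set: n.+1.-tuple RT] (fun t : n.+1.-tuple RT =>
    (geometric_product t eta * site_loss (nth 0%N eta y)
      (nth 0 (a :: rcons t B) y) (nth 0 (a :: rcons t B) y.+2))%:E).
  apply/measurable_EFinP/measurable_funM; first exact: measurable_geometric_product.
  by apply: measurable_site_loss; exact: measurable_nth_cons_rcons.
case: y => [|y] in yn mL mR *.
  (* First site: the other means are frozen, and their geometric factor comes out of the inner
     integral as a constant. *)
  rewrite !integral_ordered_means_inner//; last 2 first.
    move=> t aOt; rewrite lee_fin mulr_ge0 ?(geometric_product_ge0 _ a0 aOt)//.
    by apply: site_loss_ge0; apply: pos => //; lia.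
    move=> t aOt; rewrite lee_fin mulr_ge0 ?(geometric_product_ge0 _ a0 aOt)//.
    by apply: site_gain_ge0; apply: pos => //; lia.
  apply: eq_integral => t; rewrite inE => aOt.
  have g0 : (0 <= (geometric_product t [tuple of behead eta])%:E)%E.
    by rewrite lee_fin; exact: geometric_product_ge0 aOt.
  have at_ : a <= head B t.
    by have := ordered_means_nth_ge (i := 1) aOt isT; rewrite /= nth0 headE.
  have E (h h' : RT -> R) :
      (\int[lebesgue_measure]_(x in `[a, head B t]) (geo (thead eta) x * h x)%:E =
       \int[lebesgue_measure]_(x in `[a, head B t]) (geo (thead eta) x * h' x)%:E)%E ->
      measurable_fun setT (h : RT -> RT) -> measurable_fun setT (h' : RT -> RT) ->
      (forall x, a <= x <= head B t -> 0 <= h x) ->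
      (forall x, a <= x <= head B t -> 0 <= h' x) ->
      (\int[lebesgue_measure]_(x in `[a, head B t])
         (geometric_product (tuple_cons (x, t)) eta * h x)%:E =
       \int[lebesgue_measure]_(x in `[a, head B t])
         (geometric_product (tuple_cons (x, t)) eta * h' x)%:E)%E.
    move=> hh' mh mh' h0 h'0.
    have X f (x : R) : (geometric_product (tuple_cons (x, t)) eta * f x)%:E =
        ((geometric_product t [tuple of behead eta])%:E * (geo (thead eta) x * f x)%:E)%E.
      by rewrite geometric_product_cons -EFinM mulrCA mulrA.
    under eq_integral do rewrite X.
    under [RHS]eq_integral do rewrite X.
    have mg (f : RT -> R) : measurable_fun setT (f : RT -> RT) ->
        measurable_fun `[a, head B t] (fun x : RT => (geo (thead eta) x * f x)%:E).
      move=> mf; apply: measurable_funTS; apply/measurable_EFinP.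
      by apply: measurable_funM => //; exact: measurable_geo.
    have pg (f : RT -> R) : (forall x, a <= x <= head B t -> 0 <= f x) ->
        forall x, `[a, head B t]%classic x -> (0 <= (geo (thead eta) x * f x)%:E)%E.
      move=> f0 x /=; rewrite in_itv/= => /[dup] axh /andP[ax _].
      by rewrite lee_fin mulr_ge0 ?f0// geo_ge0// (lt_le_trans a0).
    rewrite !ge0_integralZl//; [by rewrite hh'|exact: mg|exact: pg|exact: mg|exact: pg].
  have h0 : 0 < head B t := lt_le_trans a0 at_.
  have s2 x : nth 0 (a :: rcons (tuple_cons (x, t)) B) 2 = head B t.
    by rewrite /tuple_cons /= nth0 headE.
  have k0 : nth 0%N eta 0 = thead eta by rewrite /thead (tnth_nth 0%N).
  under eq_integral do rewrite s2 k0.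
  under [RHS]eq_integral do rewrite s2 k0.
  apply: (E (fun x => site_gain (thead eta) a x (head B t))
            (fun x => site_loss (thead eta) a (head B t))).
  - exact: integral_one_site.
  - by apply: measurable_site_gain;
      [exact: measurable_cst|exact: measurable_id|exact: measurable_cst].
  - exact: measurable_cst.
  - by move=> x /andP[ax _]; apply: site_gain_ge0 => //; exact: lt_le_trans ax.
  - by move=> x _; exact: site_loss_ge0.
(* Later site: the first mean [x] contributes only the factor [geo (thead eta) x], and the induction
   hypothesis is used with lower end [x]. *)
rewrite !integral_ordered_means_outer//; last 2 first.
  move=> t aOt; rewrite lee_fin mulr_ge0 ?(geometric_product_ge0 _ a0 aOt)//.
  by apply: site_loss_ge0; apply: pos => //; lia.
  move=> t aOt; rewrite lee_fin mulr_ge0 ?(geometric_product_ge0 _ a0 aOt)//.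
  by apply: site_gain_ge0; apply: pos => //; lia.
apply: eq_integral => x; rewrite inE => xaB.
have ax : a <= x by move: xaB; rewrite /= in_itv => /andP[].
have x0 := lt_le_trans a0 ax.
have g0 : (0 <= (geo (thead eta) x)%:E)%E by rewrite lee_fin geo_ge0.
have s1 (t : n.-tuple RT) i : nth 0 (a :: rcons (tuple_cons (x, t)) B) i.+1 =
    nth 0 (x :: rcons t B) i by [].
have k1 : nth 0%N eta y.+1 = nth 0%N [tuple of behead eta] y.
  by rewrite /= nth_behead.
have X f (t : n.-tuple RT) : (geometric_product (tuple_cons (x, t)) eta * f)%:E =
    ((geo (thead eta) x)%:E * (geometric_product t [tuple of behead eta] * f)%:E)%E.
  by rewrite geometric_product_cons -EFinM mulrA.
under eq_integral do rewrite !s1 k1 X.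
under [RHS]eq_integral do rewrite !s1 k1 X.
have pos' (t : n.-tuple RT) i : ordered_means x B t -> (i <= n.+1)%N ->
    0 < nth 0 (x :: rcons t B) i.
  by move=> xOt i_n; apply: lt_le_trans x0 _; exact: ordered_means_nth_ge.
have mO := @measurable_ordered_means R B n x.
rewrite !ge0_integralZl//; first by rewrite IH.
- apply: measurable_funTS; apply/measurable_EFinP/measurable_funM.
    exact: measurable_geometric_product.
  by apply: measurable_site_loss; exact: measurable_nth_cons_rcons.
- move=> t xOt; rewrite lee_fin mulr_ge0 ?(geometric_product_ge0 _ x0 xOt)//.
  by apply: site_loss_ge0; apply: pos' => //; lia.
- apply: measurable_funTS; apply/measurable_EFinP/measurable_funM.
    exact: measurable_geometric_product.
  by apply: measurable_site_gain; exact: measurable_nth_cons_rcons.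
- move=> t xOt; rewrite lee_fin mulr_ge0 ?(geometric_product_ge0 _ x0 xOt)//.
  by apply: site_gain_ge0; apply: pos' => //; lia.
Qed.

End sites.

(** * Volume of the simplex of ordered means *)

Section volume.
Context {R : realType}.
Local Notation RT := (measurableTypeR R).
Variable B : R.

(** Induction on [n]: the slice above a first mean [x] has volume (B - x)^n / n!, which is then
    integrated from [a] to [B]. For [n = 0] the measure is a Dirac mass, and [a <= B] puts the empty
    tuple in the set. *)
Lemma lebesgue_ordered_means n a : a <= B ->
  lebesgue_tuple n (ordered_means a B : set (n.-tuple RT)) =
  ((B - a) ^+ n / n`!%:R)%:E.
Proof.
elim: n a => [|n IH] a aB.
  rewrite /= expr0 fact0 divr1 diracE mem_set//.
  by rewrite /ordered_means /= aB.
have mO k x := @measurable_ordered_means R B k x.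
transitivity (\int[lebesgue_tuple n.+1]_(t in ordered_means a B)
    (cst 1 t : \bar R))%E.
  by rewrite integral_cst ?mul1e; last exact: mO.
rewrite integral_ordered_means_outer//.
transitivity (\int[lebesgue_measure]_(x in `[a, B]) ((B - x) ^+ n / n`!%:R)%:E)%E.
  apply: eq_integral => x; rewrite inE/= in_itv/= => /andP[_ xB].
  by rewrite -IH// integral_cst ?mul1e; last exact: mO.
pose F x := - (((B - x) ^+ n.+1) / (n.+1)`!%:R).
have nf : n`!%:R != 0 :> R by rewrite pnatr_eq0 -lt0n fact_gt0.
have n1 : n.+1%:R != 0 :> R by rewrite pnatr_eq0.
have dF (x : R) : is_derive x 1 F ((B - x) ^+ n / n`!%:R).
  rewrite (_ : F = - ((n.+1)`!%:R)^-1 *: (cst B - id) ^+ n.+1); last first.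
    by apply/funext => y; rewrite /F /= exprfctE scaleNr mulrC.
  apply: is_derive_eq; rewrite /GRing.scale/= sub0r factS natrM.
  rewrite /cst !fctE /=; move: (n.+1%:R) (n`!%:R) n1 nf => u v u0 v0.
  by field; rewrite u0 v0.
rewrite (@integral_is_derive _ F (fun x => (B - x) ^+ n / n`!%:R))//.
- by rewrite /F subrr expr0n/= mul0r oppr0 sub0r opprK.
- move=> x _; apply: cvgM; last exact: cvg_cst.
  apply: (@continuous_comp _ _ _ (fun y => B - y) (fun y => y ^+ n));
    last exact: exprn_continuous.
  by apply: cvgB; [exact: cvg_cst|exact: cvg_id].
Qed.

End volume.

(** * Particle moves *)

Section moves.
Variable n : nat.
Local Notation conf := (config n.+1).

(* A place is a site or a reservoir; [inr false] is the left reservoir, in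
   contact with the first site, and [inr true] the right one. *)
Definition place : Type := ('I_n.+1 + bool)%type.

Definition end_site (b : bool) : 'I_n.+1 := if b then ord_max else ord0.

Definition adj (s d : place) : bool :=
  match s, d with
  | inl x, inl y => (y == x.+1 :> nat) || (x == y.+1 :> nat)
  | inl x, inr b | inr b, inl x => x == end_site b
  | inr _, inr _ => false
  end.

Definition avail (k : nat) (s : place) (eta : conf) : bool :=
  if s is inl x then (k <= tnth eta x)%N else true.

Definition take_from (k : nat) (s : place) (eta : conf) : conf :=
  if s is inl x then remove_particles k x eta else eta.

Definition put_in (k : nat) (d : place) (eta : conf) : conf :=
  if d is inl x then add_particles k x eta else eta.

Definition move k s d (eta : conf) : conf := put_in k d (take_from k s eta).

Arguments move : simpl never.

Lemma adjC s d : adj s d = adj d s.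
Proof. by case: s d => [x|b] [y|c] //=; rewrite orbC. Qed.

Lemma tnth_add k x (eta : conf) y :
  tnth (add_particles k x eta) y = (tnth eta y + (y == x) * k)%N.
Proof. by rewrite tnth_mktuple. Qed.

Lemma tnth_remove k x (eta : conf) y :
  tnth (remove_particles k x eta) y = (tnth eta y - (y == x) * k)%N.
Proof. by rewrite tnth_mktuple. Qed.

Lemma tnth_take k s (eta : conf) y :
  tnth (take_from k s eta) y = (tnth eta y - (inl y == s) * k)%N.
Proof. by case: s => [x|b] /=; rewrite ?tnth_remove ?subn0. Qed.

Lemma tnth_move k s d (eta : conf) y : tnth (move k s d eta) y =
  (tnth eta y - (inl y == s) * k + (inl y == d) * k)%N.
Proof. by rewrite /move; case: d => [x|b] /=; rewrite ?tnth_add tnth_take ?addn0. Qed.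

Lemma adj_neq s d : adj s d -> s != d.
Proof.
case: s d => [x|b] [y|c] //=; apply: contraTneq => -[->].
by rewrite orbb eqn_leq ltnn andbF.
Qed.

Lemma avail_move k s d (eta : conf) : adj s d -> avail k s eta ->
  avail k d (move k s d eta).
Proof.
move=> /adj_neq sd; case: d sd => //= y sd _.
by rewrite tnth_move eqxx mul1n leq_addl.
Qed.

Lemma moveK k s d (eta : conf) : adj s d -> avail k s eta ->
  move k d s (move k s d eta) = eta.
Proof.
move=> /adj_neq sd av; apply: eq_from_tnth => y; rewrite !tnth_move.
case: (eqVneq (inl y) s) => [ys|_]; last by rewrite mul0n subn0 addn0 addnK.
rewrite ys (negbTE sd) !mul0n mul1n addn0 subn0 subnK//.
by move: av; rewrite -ys.
Qed.

(** Counting reservoirs, every site has exactly two distinct neighbours, even when there is a single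
    site. *)
Lemma big_adj_site (T : Type) (idx : T) (op : Monoid.com_law idx)
    (F : place -> T) (y : 'I_n.+1) :
  let l := if y == ord0 then inr false else inl (inord y.-1) in
  let r := if y == ord_max then inr true else inl (inord y.+1) in
  \big[op/idx]_(s | adj s (inl y)) F s = op (F l) (F r).
Proof.
move=> l r.
have yn : (y <= n)%N by rewrite -ltnS.
have y0E : (y == ord0) = (y == 0 :> nat)%N by [].
have ynE : (y == ord_max) = (y == n :> nat) by [].
have al : adj l (inl y).
  rewrite /l y0E; case: eqP => [y0|y0]/=; first by apply/eqP/val_inj.
  by rewrite inordK; lia.
have ar : adj r (inl y).
  rewrite /r ynE; case: eqP => [y0|y0]/=; first by apply/eqP/val_inj.
  by rewrite inordK ?eqxx ?orbT//; lia.
have rl : r != l.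
  rewrite /r /l ynE y0E; case: (boolP (y == n :> nat)) => [/eqP y1|/eqP y1];
    case: (boolP (y == 0%N :> nat)) => [/eqP y2|/eqP y2] //.
  by apply/eqP => -[/(congr1 (@nat_of_ord _))]; rewrite !inordK; lia.
rewrite (bigD1 l)//= (bigD1 r)/=; last by rewrite ar.
rewrite big_pred0 ?Monoid.mulm1// => s.
apply/negP => /andP[/andP[asy sl] sr].
case: s asy sl sr => [x|b].
- rewrite /= => /orP[/eqP yx|/eqP xy].
  + move=> /eqP sl _; apply: sl; rewrite /l y0E yx /=; congr inl.
    by apply/val_inj; rewrite /= inordK.
  + move=> _ /eqP sr; apply: sr; rewrite /r ynE; case: (boolP (y == n :> nat)) => [/eqP ye|_].
      by have := ltn_ord x; lia.
    by congr inl; apply/val_inj; rewrite /= -xy inord_val.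
- by rewrite /= /l /r => /eqP ->; case: b => /=; rewrite ?eqxx.
Qed.

Lemma big_adj_reservoir (T : Type) (idx : T) (op : Monoid.com_law idx)
    (F : place -> T) b :
  \big[op/idx]_(s | adj s (inr b)) F s = F (inl (end_site b)).
Proof.
rewrite (bigD1 (inl (end_site b)))/= ?eqxx// big_pred0 ?Monoid.mulm1//.
by case=> [x|c]//=; apply/negP => /andP[/eqP -> /eqP].
Qed.

End moves.

(** * Probability flows between configurations, and the balance equation in terms of them *)

Section flows.
Context {R : realType} (n : nat) (bA bB : R).
Local Notation conf := (config n.+1).
Local Open Scope ereal_scope.

Definition weight (s : place n) : R :=
  if s is inr b then if b then bB else bA else 1%R.

(* [rate s 0 = 0] because of [0^-1 = 0], so sums over k can start at 0. *)
Definition rate (s : place n) (k : nat) : R := (weight s ^+ k / k%:R)%R.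

(** Jumps are indexed by their reversal: the configuration from which [k] particles go from [s] to
    [d] to produce [eta] is [move k d s eta], and it exists exactly when [k] particles are available
    at [d] in [eta]. *)
Definition inflow (u : conf -> \bar R) (eta : conf) : \bar R :=
  \sum_(d : place n) \sum_(s : place n | adj s d) \sum_(0 <= k <oo)
    (if avail k d eta then (rate s k)%:E * u (move k d s eta) else 0).

(** The adjoint of [inflow]: jump rates out of [eta], weighted by [g] at the target. The constant
    function 1 gives the total exit rate. *)
Definition outflow (g : conf -> \bar R) (eta : conf) : \bar R :=
  \sum_(s : place n) \sum_(d : place n | adj d s) \sum_(0 <= k <oo)
    (if avail k s eta then (rate s k)%:E * g (move k s d eta) else 0).

Lemma rate0 s : rate s 0 = 0%R.
Proof. by rewrite /rate invr0 mulr0. Qed.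

Lemma nneseries_from1 (f : nat -> \bar R) : f 0%N = 0 -> (forall k, 0 <= f k) ->
  \sum_(1 <= k <oo) f k = \sum_(0 <= k <oo) f k.
Proof. by move=> f0 f_ge0; rewrite [RHS]nneseries_recl// f0 add0e. Qed.

Lemma nneseries_if_leq (f : nat -> \bar R) m : f 0%N = 0 -> (forall k, 0 <= f k) ->
  \sum_(0 <= k <oo) (if (k <= m)%N then f k else 0) = \sum_(1 <= k < m.+1) f k.
Proof.
move=> f0 f_ge0; rewrite (nneseries_split _ m.+1); last by move=> k _; case: ifP.
rewrite add0n [X in _ + X]eseries0 ?adde0; last first.
  by move=> k mk _; rewrite leqNgt mk.
rewrite big_nat_recl// f0 leq0n add0e big_add1; apply: eq_big_nat => k /andP[_ km].
by rewrite km.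
Qed.

Hypotheses (bA0 : (0 <= bA)%R) (bB0 : (0 <= bB)%R).

Lemma rate_ge0 s k : (0 <= rate s k)%R.
Proof. by rewrite divr_ge0// exprn_ge0//; case: s => [x|[]]. Qed.

Lemma big_place (F : place n -> \bar R) (P : pred (place n)) :
  \sum_(s | P s) F s =
  \sum_(x | P (inl x)) F (inl x) + \sum_(b | P (inr b)) F (inr b).
Proof. by rewrite big_sumType. Qed.

(** A creation is a jump out of a reservoir and an annihilation a jump into one, so the six sums of
    the stationarity condition merge into a single sum over adjacent places. *)
Lemma inflowE (u : conf -> \bar R) (eta : conf) : (forall xi, 0 <= u xi) ->
  \sum_(1 <= k < (tnth eta ord0).+1)
      u (remove_particles k ord0 eta) * (bA ^+ k / k%:R)%:E
  + \sum_(1 <= k <oo) u (add_particles k ord0 eta) * (k%:R^-1)%:E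
  + \sum_(x < n.+1) \sum_(y < n.+1 | y == x.+1 :> nat)
      \sum_(1 <= k < (tnth eta y).+1)
        u (add_particles k x (remove_particles k y eta)) * (k%:R^-1)%:E
  + \sum_(x < n.+1) \sum_(y < n.+1 | x == y.+1 :> nat)
      \sum_(1 <= k < (tnth eta y).+1)
        u (add_particles k x (remove_particles k y eta)) * (k%:R^-1)%:E
  + \sum_(1 <= k < (tnth eta ord_max).+1)
      u (remove_particles k ord_max eta) * (bB ^+ k / k%:R)%:E
  + \sum_(1 <= k <oo) u (add_particles k ord_max eta) * (k%:R^-1)%:E
  = inflow u eta.
Proof.
move=> u0.
pose J s d : \bar R := \sum_(0 <= k <oo)
    (if avail k d eta then (rate s k)%:E * u (move k d s eta) else 0).
have ru0 s d k : 0 <= (rate s k)%:E * u (move k d s eta).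
  by rewrite mule_ge0// lee_fin rate_ge0.
have ru s d : (rate s 0)%:E * u (move 0 d s eta) = 0 by rewrite rate0 mul0e.
have J_site s y : \sum_(1 <= k < (tnth eta y).+1)
    u (move k (inl y) s eta) * (rate s k)%:E = J s (inl y).
  rewrite /J /= nneseries_if_leq//.
  by apply: eq_bigr => k _; rewrite muleC.
have J_res s b : \sum_(1 <= k <oo) u (move k (inr b) s eta) * (rate s k)%:E =
    J s (inr b).
  rewrite /J /= -nneseries_from1//.
  by apply: eq_eseriesr => k _; rewrite muleC.
have rE k (x : 'I_n.+1) : (k%:R^-1 = rate (inl x) k)%R by rewrite /rate expr1n mul1r.
have -> : inflow u eta =
    \sum_(y < n.+1) \sum_(x < n.+1 | adj (inl x) (inl y)) J (inl x) (inl y)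
    + (J (inr true) (inl ord_max) + J (inr false) (inl ord0)) +
    (J (inl ord_max) (inr true) + J (inl ord0) (inr false)).
  rewrite /inflow (@big_place _ xpredT); congr (_ + _).
    under eq_bigr do rewrite big_place.
    rewrite big_split/=; congr (_ + _).
    rewrite (exchange_big_dep xpredT)//= big_bool/=.
    by rewrite (big_pred1 (end_site n true))// (big_pred1 (end_site n false)).
  by rewrite big_bool/= !big_adj_reservoir.
rewrite -!J_site -!J_res/=.
have bulk x y : \sum_(1 <= k < (tnth eta y).+1)
    u (add_particles k x (remove_particles k y eta)) * (k%:R^-1)%:E =
    J (inl x) (inl y).
  by rewrite -J_site; apply: eq_bigr => k _; rewrite (rE k x).
under [X in _ + X + _ + _ + _ = _]eq_bigr do under eq_bigr do rewrite bulk.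
under [X in _ + X + _ + _ = _]eq_bigr do under eq_bigr do rewrite bulk.
(* The two alternatives of the disjunction exclude each other, so the sum over neighbours splits
   into right and left ones. *)
have -> : \sum_(y < n.+1)
      \sum_(x < n.+1 | (y == x.+1 :> nat) || (x == y.+1 :> nat)) J (inl x) (inl y) =
    \sum_(x < n.+1) \sum_(y < n.+1 | y == x.+1 :> nat) J (inl x) (inl y) +
    \sum_(x < n.+1) \sum_(y < n.+1 | x == y.+1 :> nat) J (inl x) (inl y).
  rewrite (exchange_big_dep xpredT)//= -big_split /=; apply: eq_bigr => x _.
  rewrite [in LHS]big_mkcond !(big_mkcond (fun y : 'I_n.+1 => _ == _)) -big_split /=.
  apply: eq_bigr => y _; case: eqP => [->|_] /=; last by rewrite add0e.
  by rewrite ltn_eqF ?adde0// ltnW.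
rewrite [LHS](ACl (3*4*(5*1)*(6*2)))/=; congr (_ + (_ + _)).
  by apply: eq_eseriesr => k _; rewrite (rE k ord_max).
by apply: eq_eseriesr => k _; rewrite (rE k ord0).
Qed.

(** The factor 2 counts the two neighbours of each site, reservoirs included. *)
Lemma outflow1E (eta : conf) :
  \sum_(1 <= k <oo) (bA ^+ k / k%:R)%:E
  + \sum_(x < n.+1) \sum_(1 <= k < (tnth eta x).+1) (2 / k%:R)%:E
  + \sum_(1 <= k <oo) (bB ^+ k / k%:R)%:E = outflow (fun=> 1) eta.
Proof.
have r0 s k : 0 <= (rate s k)%:E by rewrite lee_fin rate_ge0.
have rz s : (rate s 0)%:E = 0 by rewrite rate0.
have out_site x : \sum_(d | adj d (inl x)) \sum_(0 <= k <oo)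
    (if avail k (inl x) eta then (rate (inl x) k)%:E * 1 else 0) =
    \sum_(1 <= k < (tnth eta x).+1) (2 / k%:R)%:E.
  rewrite big_adj_site/=.
  under eq_eseriesr do rewrite mule1.
  rewrite nneseries_if_leq// -big_split/=; apply: eq_bigr => k _.
  by rewrite -EFinD /rate /= expr1n mul1r -mulr2n mulr_natl.
have out_res b : \sum_(0 <= k <oo)
    (if avail k (inr b) eta then (rate (inr b) k)%:E * 1 else 0) =
    \sum_(1 <= k <oo) (rate (inr b) k)%:E.
  by rewrite nneseries_from1//; apply: eq_eseriesr => k _; rewrite mule1.
rewrite /outflow (@big_place _ xpredT) big_bool !big_adj_reservoir !out_res.
under [in RHS]eq_bigr do rewrite out_site.
by rewrite [LHS](ACl (2*(3*1))).
Qed.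

Lemma inflowZ (c : R) (u : conf -> \bar R) eta : (forall xi, 0 <= u xi) ->
  inflow (fun xi => c%:E * u xi) eta = c%:E * inflow u eta.
Proof.
move=> u0.
have t0 d s k : 0 <= (rate s k)%:E * u (move k d s eta).
  by rewrite mule_ge0// lee_fin rate_ge0.
have S0 d s : (0 <= \sum_(0 <= k <oo) (if avail k d eta then
    (rate s k)%:E * u (move k d s eta) else 0))%E.
  by apply: nneseries_ge0 => k _ _; case: ifP.
rewrite /inflow ge0_sume_distrr; last by move=> d _; apply: sume_ge0 => s _; exact: S0.
apply: eq_bigr => d _; rewrite ge0_sume_distrr; last by move=> s _; exact: S0.
apply: eq_bigr => s _; rewrite -nneseriesZl; last by move=> k _; case: ifP.
by apply: eq_eseriesr => k _; case: ifP => _; rewrite ?mule0// muleCA.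
Qed.

End flows.

(** * Stationarity of the mixture *)

Section inflow_integral.
Context {R : realType} (n : nat) (bA bB : R).
Hypotheses (bA0 : 0 <= bA) (bB0 : 0 <= bB).
Local Notation conf := (config n.+1).
Local Open Scope ereal_scope.

Lemma inflow_integral d (T : measurableType d)
    (mu : {measure set T -> \bar R}) (D : set T) (u : T -> conf -> \bar R) eta :
  measurable D -> (forall xi, measurable_fun D (u ^~ xi)) ->
  (forall m xi, D m -> 0 <= u m xi) ->
  \int[mu]_(m in D) inflow bA bB (u m) eta =
  inflow bA bB (fun xi => \int[mu]_(m in D) u m xi) eta.
Proof.
move=> mD mu_ u0.
pose f d s k m := if avail k d eta then (rate bA bB s k)%:E * u m (move k d s eta) else 0.
have f0 d' s k m : D m -> 0 <= f d' s k m.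
  by move=> Dm; rewrite /f; case: ifP => // _; rewrite mule_ge0 ?u0// lee_fin rate_ge0.
have mf d' s k : measurable_fun D (f d' s k).
  rewrite /f; case: avail; last exact: measurable_cst.
  by apply: emeasurable_funM => //; exact: measurable_cst.
have mS d' s : measurable_fun D (fun m => \sum_(0 <= k <oo) f d' s k m).
  by apply: ge0_emeasurable_sum => // k m /f0.
have S0 d' s m : D m -> 0 <= \sum_(0 <= k <oo) f d' s k m.
  by move=> Dm; apply: nneseries_ge0 => k _ _; exact: f0.
rewrite /inflow ge0_integral_sum//; last 2 first.
  - by move=> d'; under eq_fun do rewrite -big_filter; apply: emeasurable_sum => s; exact: mS.
  - by move=> d' m Dm; apply: sume_ge0 => s _; exact: S0.
apply: eq_bigr => d' _.
under eq_integral do rewrite -big_filter.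
rewrite (@ge0_integral_sum _ _ _ _ _ _ _
  (fun s m => \sum_(0 <= k <oo) f d' s k m))//; last by move=> s m; exact: S0.
rewrite big_filter; apply: eq_bigr => s _.
rewrite (@integral_nneseries _ _ _ _ _ _ (f d' s))//; last by move=> k m; exact: f0.
apply: eq_eseriesr => k _; rewrite /f; case: ifP => _; last by rewrite integral0.
rewrite ge0_integralZl//; first by move=> m; exact: u0.
by rewrite lee_fin rate_ge0.
Qed.

End inflow_integral.

(** * The inflow of a product of geometric laws with fixed ordered means *)

Section geometric.
Context {R : realType} (n : nat).
Local Notation RT := (measurableTypeR R).
Variables (a B : R) (m : n.+1.-tuple RT).
Hypotheses (a0 : 0 < a) (aOm : ordered_means a B m).
Local Notation s := (nth 0 (a :: rcons m B)).

Lemma ordered_means_gt0 i : (i <= n.+2)%N -> 0 < s i.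
Proof. by move=> ni; apply: lt_le_trans a0 _; exact: ordered_means_nth_ge. Qed.

Lemma nth_site (x : 'I_n.+1) : s x.+1 = tnth m x.
Proof. by rewrite /= nth_rcons size_tuple ltn_ord (tnth_nth 0). Qed.

Lemma nth_last : s n.+2 = B.
Proof. by rewrite /= nth_rcons size_tuple ltnn eqxx. Qed.

(** A reservoir gets the value 1 because its fugacity already sits in [rate], through [weight]; the
    product of the two is the fugacity of the place in all cases. *)
Definition fug_site (p : place n) : R :=
  if p is inl x then fugacity (tnth m x) else 1.

Lemma fug_site_gt0 p : 0 < fug_site p.
Proof.
case: p => //= x; apply: fugacity_gt0; rewrite -nth_site.
by apply: ordered_means_gt0; rewrite ltnS ltnW.
Qed.

Lemma geometric_productM (eta : config n.+1) : geometric_product m eta =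
  \prod_(x < n.+1) (1 / (1 + tnth m x)) *
  \prod_(x < n.+1) fugacity (tnth m x) ^+ tnth eta x.
Proof. by rewrite -big_split. Qed.

Lemma geometric_product_put k p (eta : config n.+1) :
  geometric_product m (put_in k p eta) =
  geometric_product m eta * fug_site p ^+ k.
Proof.
case: p => [x|b] /=; last by rewrite expr1n mulr1.
rewrite !geometric_productM -mulrA; congr (_ * _).
rewrite (bigD1 x)//= [in RHS](bigD1 x)//= tnth_add eqxx mul1n exprD [LHS]mulrAC.
congr (_ * _ * _); apply: eq_bigr => y /negbTE yx.
by rewrite tnth_add yx mul0n addn0.
Qed.

Lemma put_takeK k p (eta : config n.+1) : avail k p eta ->
  put_in k p (take_from k p eta) = eta.
Proof.
case: p => //= x av; apply: eq_from_tnth => y.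
rewrite tnth_add tnth_remove; case: eqP => [->|_]; last by rewrite subn0 addn0.
by rewrite mul1n subnK.
Qed.

Lemma geometric_product_move k d p (eta : config n.+1) : avail k d eta ->
  geometric_product m (move k d p eta) =
  geometric_product m eta * (fug_site p / fug_site d) ^+ k.
Proof.
move=> av; rewrite /move geometric_product_put.
have := geometric_product_put k d (take_from k d eta).
rewrite put_takeK// => ->; rewrite expr_div_n.
have d0 : fug_site d ^+ k != 0 by rewrite expf_neq0// gt_eqF// fug_site_gt0.
by field.
Qed.

Definition total_gain (eta : config n.+1) : R :=
  \sum_(y < n.+1) (hsum (tnth eta y) (fugacity (s y) / fugacity (s y.+1)) +
     hsum (tnth eta y) (fugacity (s y.+2) / fugacity (s y.+1))) +
  (ln (1 + s n.+1) + ln (1 + s 1)).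

(** Moving [k] particles multiplies the product weight by the k-th power of a ratio of fugacities.
    Jumps into a site are limited by its occupation and sum to [hsum]; jumps into a reservoir are
    unlimited and sum to a full logarithmic series, which gives the two terms [ln (1 + s n.+1)] and
    [ln (1 + s 1)]. *)
Lemma inflow_geometric (eta : config n.+1) :
  inflow (fugacity a) (fugacity B) (fun xi => (geometric_product m xi)%:E) eta =
  (geometric_product m eta * total_gain eta)%:E.
Proof.
have G0 := geometric_product_ge0 eta a0 aOm.
pose q (p : place n) : R := match p with
  | inl x => fugacity (tnth m x)
  | inr b => if b then fugacity B else fugacity a end.
have qE p : weight (fugacity a) (fugacity B) p * fug_site p = q p.
  by case: p => [x|b] /=; rewrite ?mul1r ?mulr1.
have q0 p : 0 < q p.
  case: p => [x|[]] /=; first exact: (fug_site_gt0 (inl x)).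
    by rewrite -nth_last fugacity_gt0// ordered_means_gt0.
  exact: fugacity_gt0.
have E d p k : avail k d eta ->
  ((rate (fugacity a) (fugacity B) p k)%:E * (geometric_product m (move k d p eta))%:E =
  (geometric_product m eta)%:E * ((q p / fug_site d) ^+ k / k%:R)%:E)%E.
  move=> av; rewrite geometric_product_move// -!EFinM; congr EFin.
  rewrite /rate -qE -[_ * _ / fug_site d]mulrA [in RHS]exprMn.
  by move: (_ ^+ k) (_ ^+ k) => u v; ring.
have Jsite p y : (\sum_(0 <= k <oo) (if avail k (inl y) eta then
      (rate (fugacity a) (fugacity B) p k)%:E *
      (geometric_product m (move k (inl y) p eta))%:E else 0))%E =
    (geometric_product m eta * hsum (tnth eta y) (q p / q (inl y)))%:E.
  transitivity (\sum_(0 <= k <oo) (if (k <= tnth eta y)%N then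
     (geometric_product m eta)%:E * ((q p / q (inl y)) ^+ k / k%:R)%:E else 0))%E.
    by apply: eq_eseriesr => k _ /=; case: ifP => // av; rewrite E.
  rewrite nneseries_if_leq.
  - rewrite EFinM -sumEFin ge0_sume_distrr// => k _.
    by rewrite lee_fin divr_ge0// exprn_ge0// divr_ge0// ltW.
  - by rewrite invr0 mulr0 mule0.
  - by move=> k; rewrite -EFinM lee_fin mulr_ge0// divr_ge0// exprn_ge0// divr_ge0// ltW.
have Jres b x : (\sum_(0 <= k <oo) (if avail k (inr b) eta then
      (rate (fugacity a) (fugacity B) (inl x) k)%:E *
      (geometric_product m (move k (inr b) (inl x) eta))%:E else 0))%E =
    (geometric_product m eta * ln (1 + tnth m x))%:E.
  transitivity (\sum_(0 <= k <oo)
     (geometric_product m eta)%:E * (fugacity (tnth m x) ^+ k / k%:R)%:E)%E.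
    by apply: eq_eseriesr => k _; rewrite E//= divr1.
  rewrite nneseriesZl; last first.
    move=> k _; rewrite lee_fin divr_ge0// exprn_ge0// ltW//.
    exact: (q0 (inl x)).
  rewrite nneseries_ln1D//.
  by rewrite -nth_site ordered_means_gt0// ltnS ltnW.
rewrite /inflow (@big_place _ _ _ xpredT) /total_gain mulrDr EFinD; congr (_ + _)%E.
  rewrite mulr_sumr -sumEFin; apply: eq_bigr => y _.
  rewrite big_adj_site /= !Jsite -EFinD -mulrDr;
    congr (_ * (hsum _ (_ / _) + hsum _ (_ / _)))%:E.
  - case: (eqVneq y ord0) => [->//|y0].
    have y_gt0 : (0 < y)%N by rewrite lt0n.
    rewrite /q -nth_site inordK; last by have := ltn_ord y; lia.
    by rewrite prednK.
  - by rewrite -[RHS]/(fugacity (s y.+1)) nth_site.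
  - rewrite -[RHS]/(fugacity (s y.+2)).
    case: (eqVneq y ord_max) => [->|yn]; first by rewrite nth_last.
    have y_ltn : (y < n)%N by move: yn (ltn_ord y); rewrite -val_eqE /=; lia.
    by rewrite /q -nth_site inordK// ltnS.
  - by rewrite -[RHS]/(fugacity (s y.+1)) nth_site.
rewrite big_bool !big_adj_reservoir !Jres mulrDr EFinD.
by rewrite -(nth_site ord_max) -(nth_site ord0).
Qed.

End geometric.

(** * Gain and loss have the same integral over the simplex *)

Section mixture_stationary.
Context {R : realType} (n : nat).
Local Notation RT := (measurableTypeR R).
Variables (a B : R).
Hypotheses (a0 : 0 < a) (aB : a < B).
Local Notation conf := (config n.+1).
Local Notation O := (ordered_means a B : set (n.+1.-tuple RT)).
Local Notation s m := (nth 0 (a :: rcons m B)).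
Local Notation mu := (@lebesgue_tuple R n.+1).

Let B0 : 0 < B. Proof. exact: lt_trans aB. Qed.
Let mO : measurable O := @measurable_ordered_means R B n.+1 a.

Definition total_loss (eta : conf) : R :=
  \sum_(y < n.+1) 2 * hsum (tnth eta y) 1 + (ln (1 + a) + ln (1 + B)).

Lemma outflow1_total_loss (eta : conf) :
  outflow (fugacity a) (fugacity B) (fun=> 1%E) eta = (total_loss eta)%:E.
Proof.
have fa := fugacity_gt0 a0; have fB := fugacity_gt0 B0.
rewrite -outflow1E ?ltW// !nneseries_from1.
- rewrite !nneseries_ln1D// /total_loss EFinD [in RHS]EFinD.
  rewrite [LHS](ACl (2*(1*3)))/=; congr (_ + _)%E.
  rewrite -sumEFin; apply: eq_bigr => x _; rewrite sumEFin mulr_sumr.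
  by congr EFin; apply: eq_bigr => k _; rewrite expr1n mul1r.
all: try by rewrite invr0 mulr0.
all: by move=> k; rewrite lee_fin divr_ge0// exprn_ge0// ltW.
Qed.

Let l (m : n.+1.-tuple RT) i : R := ln (1 + s m i).
Let ends m : R := l m n.+1 + l m 1.
(** Added to gain and to loss, this supplies the term [2 * ln (1 + m)] that each [site_gain]
    contains, so that both totals become sums of one-site terms plus the common remainder [ends]. *)
Let inner m : R := 2 * \sum_(y < n.+1) l m y.+1.

Lemma total_gainE m (eta : conf) : total_gain a B m eta + inner m =
  \sum_(y < n.+1) site_gain (tnth eta y) (s m y) (s m y.+1) (s m y.+2) + ends m.
Proof.
rewrite /total_gain /inner addrAC; congr (_ + _).
by rewrite mulr_sumr -big_split.
Qed.

Lemma total_lossE m (eta : conf) : total_loss eta + inner m =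
  \sum_(y < n.+1) site_loss (tnth eta y) (s m y) (s m y.+2) + ends m.
Proof.
rewrite /site_loss !big_split /= /total_loss /inner /ends.
(* [E1] and [E2] are index shifts: the logarithms at the left and right neighbours, completed by
   [ends], amount to twice those at the sites plus the two reservoir terms. *)
have E1 : \sum_(y < n.+1) l m y + l m n.+1 = l m 0 + \sum_(y < n.+1) l m y.+1.
  transitivity (\sum_(y < n.+2) l m y); first by rewrite [RHS]big_ord_recr.
  by rewrite [LHS]big_ord_recl.
have E2 : l m 1 + \sum_(y < n.+1) l m y.+2 = \sum_(y < n.+1) l m y.+1 + l m n.+2.
  transitivity (\sum_(y < n.+2) l m y.+1); first by rewrite [RHS]big_ord_recl.
  by rewrite [LHS]big_ord_recr.
have -> : ln (1 + a) = l m 0 by [].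
have -> : ln (1 + B) = l m n.+2 by rewrite /l nth_last.
rewrite -/(\sum_(y < n.+1) l m y) -/(\sum_(y < n.+1) l m y.+2).
move: E1 E2; lra.
Qed.

Lemma geometric_product_le1 m (eta : conf) : O m -> geometric_product m eta <= 1.
Proof.
move=> Om; rewrite geometric_productE; apply: prodr_ile1 => x _.
have x0 : 0 < tnth m x.
  rewrite -(nth_site a B m x).
  by apply: ordered_means_gt0 => //; rewrite ltnS ltnW.
by rewrite geo_ge0//= geo_le1.
Qed.

(** Summing [integral_site] over the sites gives the equality after [inner] has been added to both
    sides; its integral is finite, hence cancels. *)
Lemma integral_gain_loss (eta : conf) :
  (\int[mu]_(m in O) (geometric_product m eta * total_gain a B m eta)%:E =
   \int[mu]_(m in O) (geometric_product m eta * total_loss eta)%:E)%E.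
Proof.
pose I (f : n.+1.-tuple RT -> RT) : \bar R :=
  (\int[mu]_(m in O) (geometric_product m eta * f m)%:E)%E.
pose good (f : n.+1.-tuple RT -> RT) :=
  measurable_fun [set: n.+1.-tuple RT] f /\ forall m, O m -> 0 <= f m.
have G0 m : O m -> 0 <= geometric_product m eta.
  exact: geometric_product_ge0.
have mI f : good f -> measurable_fun O (fun m => (geometric_product m eta * f m)%:E).
  move=> [mf _]; apply: measurable_funTS; apply/measurable_EFinP/measurable_funM => //.
  exact: measurable_geometric_product.
have pI f : good f -> forall m, O m -> (0 <= (geometric_product m eta * f m)%:E)%E.
  by move=> [_ f0] m Om; rewrite lee_fin mulr_ge0 ?G0 ?f0.
have ID f g : good f -> good g -> I (fun m => f m + g m) = (I f + I g)%E.
  move=> gf gg; rewrite -ge0_integralD//; [|exact: pI|exact: mI|exact: pI|exact: mI].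
  by apply: eq_integral => m _; rewrite mulrDr EFinD.
have IS (h : 'I_n.+1 -> n.+1.-tuple RT -> RT) : (forall y, good (h y)) ->
    I (fun m => \sum_(y < n.+1) h y m) = (\sum_(y < n.+1) I (h y))%E.
  move=> gh; rewrite -ge0_integral_sum//; [|by move=> y; exact: mI|by move=> y; exact: pI].
  by apply: eq_integral => m _; rewrite mulr_sumr sumEFin.
have pos (m : n.+1.-tuple RT) i : O m -> (i <= n.+2)%N -> 0 < s m i.
  by move=> Om; exact: ordered_means_gt0.
have gl i : (i <= n.+2)%N -> good (l ^~ i).
  move=> ni; split.
    by apply: (measurableT_comp (@measurable_ln1D R)); exact: measurable_nth_cons_rcons.
  by move=> m Om; apply: ln1D_ge0; exact: pos.
have gsum (h : 'I_n.+1 -> n.+1.-tuple RT -> RT) : (forall y, good (h y)) ->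
    good (fun m => \sum_(y < n.+1) h y m).
  move=> gh; split; first by apply: measurable_sum => y; exact: (gh y).1.
  by move=> m Om; apply: sumr_ge0 => y _; exact: (gh y).2.
have gD f g : good f -> good g -> good (fun m => f m + g m).
  move=> [mf f0] [mg g0]; split; first exact: measurable_funD.
  by move=> m Om; rewrite addr_ge0 ?f0 ?g0.
have gends : good ends by apply: gD; exact: gl.
have ginner : good inner.
  have [mS S0] : good (fun m => \sum_(y < n.+1) l m y.+1).
    by apply: (gsum (fun y m => l m y.+1)) => y; apply: gl; rewrite ltnS ltnW// ltnS ltnW.
  split; first by apply: measurable_funM => //; exact: measurable_cst.
  by move=> m Om; rewrite mulr_ge0 ?S0.
have ggain y : good (fun m => site_gain (tnth eta y) (s m y) (s m y.+1) (s m y.+2)).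
  split; first by apply: measurable_site_gain; exact: measurable_nth_cons_rcons.
  by move=> m Om; apply: site_gain_ge0; apply: pos => //; have := ltn_ord y; lia.
have gloss y : good (fun m => site_loss (tnth eta y) (s m y) (s m y.+2)).
  split; first by apply: measurable_site_loss; exact: measurable_nth_cons_rcons.
  by move=> m Om; apply: site_loss_ge0; apply: pos => //; have := ltn_ord y; lia.
have gtg : good (fun m => total_gain a B m eta).
  split.
    (* Measurability of [total_gain] is inherited from the other terms of [total_gainE]. *)
    rewrite (_ : (fun _ => _) = (fun m : n.+1.-tuple RT => \sum_(y < n.+1)
        site_gain (tnth eta y) (s m y) (s m y.+1) (s m y.+2) + ends m - inner m)).
      apply: measurable_funB; last exact: ginner.1.
      by apply: measurable_funD; [exact: (gsum _ ggain).1|exact: gends.1].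
    by apply/funext => m; rewrite -total_gainE addrK.
  move=> m Om; rewrite addr_ge0//; last by rewrite addr_ge0// ln1D_ge0// pos.
  apply: sumr_ge0 => y _; rewrite addr_ge0// hsum_ge0// divr_ge0// fugacity_ge0// ltW// pos//;
    by have := ltn_ord y; lia.
have gtl : good (fun=> total_loss eta).
  split; first exact: measurable_cst.
  move=> m Om; rewrite addr_ge0//; last by rewrite addr_ge0// ln1D_ge0.
  by apply: sumr_ge0 => y _; rewrite mulr_ge0// hsum_ge0.
have main : (I (fun m => total_gain a B m eta) + I inner =
             I (fun=> total_loss eta) + I inner)%E.
  rewrite -!ID//.
  transitivity (I (fun m => \sum_(y < n.+1)
      site_gain (tnth eta y) (s m y) (s m y.+1) (s m y.+2) + ends m)).
    by congr I; apply/funext => m; exact: total_gainE.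
  transitivity (I (fun m => \sum_(y < n.+1)
      site_loss (tnth eta y) (s m y) (s m y.+2) + ends m)); last first.
    by congr I; apply/funext => m; rewrite -total_lossE.
  rewrite (ID _ _ (gsum _ ggain) gends) (ID _ _ (gsum _ gloss) gends).
  congr (_ + _)%E; rewrite (IS _ ggain) (IS _ gloss); apply: eq_bigr => y _.
  rewrite /I (tnth_nth 0%N); exact: integral_site.
(* Cancellation in the extended reals requires finiteness: the geometric product is at most 1, all
   means are at most [B], and the simplex has finite volume. *)
have finI : I inner \is a fin_num.
  rewrite ge0_fin_numE; last by apply: integral_ge0 => m; exact: pI.
  have sB (m : n.+1.-tuple RT) i : O m -> (i <= n.+2)%N -> s m i <= B.
    move=> Om ni; rewrite -[leRHS](nth_last a B m).
    have ssize : size (a :: rcons m B) = n.+3 by rewrite /= size_rcons size_tuple.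
    have Os : sorted <=%R (a :: rcons m B) by exact: Om.
    by apply: (sorted_leq_nth le_trans lexx 0 Os); rewrite ?inE ?ssize ?ltnS.
  have innerB (m : n.+1.-tuple RT) : O m -> inner m <= 2 * (n.+1%:R * ln (1 + B)).
    move=> Om; rewrite /inner ler_wpM2l// mulr_natl -[X in _ *+ X](card_ord n.+1) -sumr_const.
    apply: ler_sum => y _; rewrite /l ler_ln ?posrE; last 2 first.
    - by rewrite addr_gt0// pos// ltnS ltnW// ltnS ltnW.
    - by rewrite addr_gt0.
    by rewrite lerD2l sB// ltnS ltnW// ltnS ltnW.
  apply: (@le_lt_trans _ _ (\int[mu]_(m in O) (cst (2 * (n.+1%:R * ln (1 + B)))%:E) m)%E).
    apply: ge0_le_integral => //.
    - by move=> m; exact: pI.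
    - exact: mI.
    - move=> m Om; rewrite lee_fin -[leRHS]mul1r ler_pM ?G0 ?innerB//.
        exact: ginner.2.
      exact: geometric_product_le1.
  by rewrite integral_cst//= lebesgue_ordered_means ?(ltW aB)// -EFinM ltry.
have /(congr1 (fun x => x - I inner)%E) := main.
by rewrite !addeK.
Qed.

End mixture_stationary.

(** * The mixture as a probability measure *)

Section countable_sums.
Context {R : realType}.
Local Open Scope ereal_scope.

(** The enumeration [pickle_inv] is injective where it is defined, and codes of no element
    contribute 0. Results on series thereby transfer to sums over configurations. *)
Lemma esum_countType (T : countType) (g : T -> \bar R) : (forall i, 0 <= g i) ->
  \esum_(i in [set: T]) g i =
  \sum_(0 <= k <oo) oapp g 0 (pickle_inv k).
Proof.
move=> g0; rewrite nneseries_esumT; last by move=> k; case: pickle_inv.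
transitivity (\esum_(k in range (@pickle T)) oapp g 0 (pickle_inv k)).
  rewrite esum_image; last by move=> x y _ _; exact: (pcan_inj (@pickleK T)).
  by apply: eq_esum => i _; rewrite pickleK_inv.
rewrite esum_mkcond; apply: eq_esum => k _; case: ifPn => //.
rewrite notin_setE => nk; case ik: (pickle_inv k) => [i|//].
by exfalso; apply: nk; exists i => //; have := @pickle_invK T k; rewrite /ocancel ik.
Qed.

Lemma esumZl (T : countType) (c : R) (g : T -> \bar R) :
  (forall i, 0 <= g i) -> (0 <= c)%R ->
  \esum_(i in [set: T]) (c%:E * g i) = c%:E * \esum_(i in [set: T]) g i.
Proof.
move=> g0 c0; rewrite !esum_countType//; last by move=> i; rewrite mule_ge0.
rewrite -nneseriesZl; last by move=> k _; case: pickle_inv.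
by apply: eq_eseriesr => k _; case: pickle_inv => //=; rewrite mule0.
Qed.

Lemma integral_esum d (U : measurableType d) (mu : {measure set U -> \bar R})
    (D : set U) (T : countType) (f : T -> U -> \bar R) : measurable D ->
  (forall i, measurable_fun D (f i)) -> (forall i x, D x -> 0 <= f i x) ->
  \int[mu]_(x in D) (\esum_(i in [set: T]) f i x) =
  \esum_(i in [set: T]) \int[mu]_(x in D) f i x.
Proof.
move=> mD mf f0.
rewrite esum_countType; last by move=> i; apply: integral_ge0 => x; exact: f0.
transitivity (\int[mu]_(x in D) (\sum_(0 <= k <oo) oapp (f ^~ x) 0 (@pickle_inv T k))).
  by apply: eq_integral => x /set_mem Dx; rewrite esum_countType// => i; exact: f0.
have -> : (fun x => \sum_(0 <= k <oo) oapp (f ^~ x) 0 (@pickle_inv T k)) =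
    (fun x => \sum_(0 <= k <oo) oapp f (cst 0) (@pickle_inv T k) x).
  by apply/funext => x; apply: eq_eseriesr => k _; case: pickle_inv.
rewrite integral_nneseries//.
- apply: eq_eseriesr => k _; case: pickle_inv => [i|] //=.
  by rewrite integral0.
- by move=> k; case: pickle_inv => [i|] /=; [exact: mf|exact: measurable_cst].
- by move=> k x Dx; case: pickle_inv => [i|] //=; exact: f0.
Qed.

Lemma measurable_config N (A : set (config N)) : measurable A.
Proof.
have m1 (eta : config N) : measurable [set eta].
  rewrite (_ : [set eta] = \bigcap_(i in [set: 'I_N])
      ((fun t : config N => tnth t i) @^-1` [set tnth eta i])).
    apply: fin_bigcap_measurable => // i _; rewrite -[X in measurable X]setTI.
    exact: (@measurable_tnth _ nat N i measurableT).
  apply/seteqP; split => [t ->//|t H]; apply: eq_from_tnth => i; exact: H.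
rewrite (_ : A = \bigcup_(k in [set: nat])
    (if @pickle_inv (config N) k is Some eta then A `&` [set eta] else set0)).
  apply: bigcupT_measurable => k; case: pickle_inv => [eta|] /=; last exact: measurable0.
  have [Aeta|Aeta] := pselect (A eta).
    by rewrite (_ : A `&` _ = [set eta])//; apply/seteqP; split=> [t []|t ->].
  rewrite (_ : A `&` _ = set0)//.
  by apply/seteqP; split=> [t [At tE]|//]; apply: Aeta; rewrite -tE.
apply/seteqP; split => [eta Aeta|eta [k _]].
  by exists (pickle eta) => //; rewrite pickleK_inv.
by case: pickle_inv => // xi [].
Qed.

Lemma measure_esum N (P : {measure set (config N) -> \bar R}) (A : set (config N)) :
  P A = \esum_(eta in A) P [set eta].
Proof.
pose F k := if @pickle_inv (config N) k is Some eta then A `&` [set eta] else set0.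
have -> : P A = P (\bigcup_k F k).
  congr (P _); apply/seteqP; split => [eta Aeta|eta [k _]].
    by exists (pickle eta) => //; rewrite /F pickleK_inv.
  by rewrite /F; case: pickle_inv => // xi [].
have mF k : measurable (F k) by exact: measurable_config.
rewrite measure_bigcup//; last first.
  move=> i j _ _ [eta []]; rewrite /F.
  case ei: (pickle_inv i) => [xi|//]; case ej: (pickle_inv j) => [zeta|//].
  move=> [_ e1] [_ e2].
  have := @pickle_invK (config N) i; have := @pickle_invK (config N) j.
  by rewrite /ocancel ei ej /= -e1 -e2 => <- <-.
rewrite esum_mkcond esum_countType; last by move=> eta; case: ifP.
rewrite (@eq_eseriesl _ _ predT) => [|k]; last by rewrite in_setT.
apply: eq_eseriesr => k _.
rewrite /F; case: pickle_inv => [eta|/=]; last by rewrite measure0.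
rewrite /=; case: ifPn => [/set_mem|] Aeta.
  by congr (P _); apply/seteqP; split=> [t []|t ->].
rewrite (_ : A `&` _ = set0) ?measure0//.
apply/seteqP; split=> [t [At tE]|//].
by move: Aeta; rewrite notin_setE -tE.
Qed.

(** The pointwise bound passes to every set and to its complement; since both total masses are 1,
    the bound on the complement is the reverse inequality. *)
Lemma measure_config_eq N (P Q : probability (config N) R) :
  (forall eta, P [set eta] <= Q [set eta]) -> forall A, P A = Q A.
Proof.
move=> PQ A.
have le A' : P A' <= Q A' by rewrite !measure_esum; apply: le_esum => eta _; exact: PQ.
apply/eqP; rewrite eq_le le /=.
have mA := measurable_config A.
have := le (~` A); rewrite !probability_setC//.
have Pf : P A \is a fin_num by exact: fin_num_measure.
have Qf : Q A \is a fin_num by exact: fin_num_measure.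
by rewrite -(fineK Pf) -(fineK Qf) -!EFinB !lee_fin; lra.
Qed.

End countable_sums.

(** * The measure with given point masses *)

Section discrete_measure.
Context {R : realType} (N : nat).
Variable p : config N -> \bar R.
Hypothesis p_ge0 : forall eta, (0 <= p eta)%E.

(** The nonnegativity proof is an argument so that the measure structure can be attached to the
    resulting term. *)
Definition discrete_measure of (forall eta, (0 <= p eta)%E) :=
  fun A : set (config N) => (\esum_(eta in A) p eta)%E.

Local Notation dm := (discrete_measure p_ge0).

Let dm0 : dm set0 = 0%E. Proof. exact: esum_set0. Qed.

Let dm_ge0 A : (0 <= dm A)%E. Proof. exact: esum_ge0. Qed.

Let dm_sigma_additive : semi_sigma_additive dm.
Proof.
move=> F mF tF mUF; rewrite /discrete_measure nneseries_sum_bigcup//.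
by apply: is_cvg_nneseries => k _ _; exact: esum_ge0.
Qed.

HB.instance Definition _ := isMeasure.Build _ _ _ dm
  dm0 dm_ge0 dm_sigma_additive.

Lemma discrete_measure1 eta : dm [set eta] = p eta.
Proof. by rewrite /discrete_measure esum_set1. Qed.

End discrete_measure.

(** * Total mass of a product of geometric laws *)

Section normalization.
Context {R : realType}.
Local Notation RT := (measurableTypeR R).

Lemma nneseries_geo (x : R) : 0 < x ->
  (\sum_(0 <= k <oo) (geo k x)%:E = 1)%E.
Proof.
move=> x0; apply/cvg_lim => //.
rewrite (_ : (fun n => _) = EFin \o series (geometric (1 / (1 + x)) (fugacity x))); last first.
  by apply/funext => n; rewrite /= sumEFin.
apply: cvg_EFin; first exact: nearW.
have := @cvg_geometric_series R (1 / (1 + x)) (fugacity x).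
rewrite ger0_norm ?fugacity_ge0 ?ltW// => /(_ (fugacity_lt1 (ltW x0))).
rewrite fugacityC// (_ : 1 / (1 + x) / (1 + x)^-1 = 1)//.
by field; rewrite gt_eqF//; lra.
Qed.

(** Induction on the number of sites: the sum over the first occupation number is a geometric series
    of value 1 and factors out. *)
Lemma esum_geometric_product N (m : N.-tuple RT) : (forall i, 0 < tnth m i) ->
  (\esum_(eta in [set: config N]) (geometric_product m eta)%:E = 1)%E.
Proof.
elim: N m => [|N IH] m m0.
  rewrite (_ : [set: config 0] = [set [tuple]]); last first.
    by apply/seteqP; split => // t _; rewrite (tuple0 t).
  by rewrite esum_set1 geometric_productE big_ord0.
case/tupleP: m m0 => x m m0.
have x0 : 0 < x by have := m0 ord0; rewrite tnth0.
have mp i : 0 < tnth m i by have := m0 (lift ord0 i); rewrite tnthS.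
pose e (z : nat * config N) : config N.+1 := [tuple of z.1 :: z.2].
rewrite (reindex_esum ([set: nat] `*`` (fun=> [set: config N])) _ e); last first.
  split => //=.
    move=> [i1 t1] [i2 t2] _ _ /(congr1 val)/= [-> tt].
    by congr (_, _); exact: val_inj.
  move=> t _; exists (thead t, [tuple of behead t]) => //.
  by rewrite /e /= -tuple_eta.
rewrite -(esum_esum (J := fun=> [set: config N])
   (a := fun i t => (geometric_product [tuple of x :: m] [tuple of i :: t])%:E)).
  rewrite -(nneseries_geo x0) nneseries_esumT; last first.
    by move=> k; rewrite lee_fin geo_ge0.
  apply: eq_esum => k _.
  transitivity (\esum_(t in [set: config N])
      ((geo k x)%:E * (geometric_product m t)%:E))%E.
    apply: eq_esum => t _; rewrite -EFinM; congr EFin.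
    rewrite (geometric_product_cons x m [tuple of k :: t]) theadE.
    by congr (_ * geometric_product _ _); exact: val_inj.
  rewrite esumZl ?geo_ge0 ?IH ?mule1// => t; rewrite lee_fin.
  by apply: prodr_ge0 => i _; apply: geo_ge0.
move=> i t _ _; rewrite lee_fin; apply: prodr_ge0 => j _.
by apply: geo_ge0; case: (unliftP ord0 j) => [j' ->|->]; rewrite ?tnthS ?tnth0.
Qed.

End normalization.

(** * The mixture has mass 1 and satisfies the balance equation *)

Section mixture_measure.
Context {R : realType} (n : nat).
Local Notation RT := (measurableTypeR R).
Variables (a B : R).
Hypotheses (a0 : 0 < a) (aB : a < B).
Local Notation conf := (config n.+1).
Local Notation O := (ordered_means a B : set (n.+1.-tuple RT)).
Local Notation mu := (@lebesgue_tuple R n.+1).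
Let c : R := ((B - a) ^+ n.+1 / n.+1`!%:R)^-1.

Let mO : measurable O := @measurable_ordered_means R B n.+1 a.

Let v_gt0 : 0 < (B - a) ^+ n.+1 / n.+1`!%:R.
Proof. by rewrite divr_gt0 ?exprn_gt0 ?subr_gt0// ltr0n fact_gt0. Qed.

Let c0 : 0 <= c. Proof. by rewrite invr_ge0 ltW. Qed.

Let G0 m (eta : conf) : O m -> (0 <= (geometric_product m eta)%:E)%E.
Proof. by move=> Om; rewrite lee_fin; exact: geometric_product_ge0 Om. Qed.

Let mG (eta : conf) : measurable_fun O (fun m => (geometric_product m eta)%:E).
Proof.
apply: measurable_funTS; apply/measurable_EFinP.
exact: measurable_geometric_product.
Qed.

Lemma mixtureE (eta : conf) : mixture a B eta =
  (c%:E * \int[mu]_(m in O) (geometric_product m eta)%:E)%E.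
Proof.
by rewrite /mixture lebesgue_ordered_means ?(ltW aB)// inver gt_eqF.
Qed.

Lemma mixture_ge0 (eta : conf) : (0 <= mixture a B eta)%E.
Proof. by rewrite mixtureE mule_ge0 ?lee_fin//; apply: integral_ge0 => m; exact: G0. Qed.

Lemma esum_mixture : (\esum_(eta in [set: conf]) mixture a B eta = 1)%E.
Proof.
under eq_esum do rewrite mixtureE.
rewrite esumZl//; last by move=> eta; apply: integral_ge0 => m; exact: G0.
rewrite -integral_esum//; last by move=> eta m; exact: G0.
rewrite (eq_integral (cst 1%E)); last first.
  move=> m /set_mem Om; apply: esum_geometric_product => i.
  rewrite -(nth_site a B m i).
  by apply: ordered_means_gt0 => //; rewrite ltnS ltnW.
rewrite integral_cst// mul1e.
transitivity (c%:E * ((B - a) ^+ n.+1 / n.+1`!%:R)%:E)%E.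
  by congr (_ * _)%E; exact: lebesgue_ordered_means (ltW aB).
by rewrite -EFinM mulVf// gt_eqF.
Qed.

(** The inflow commutes with scaling and with the integral over the means. [inflow_geometric] then
    evaluates the integrand at each [m], and [integral_gain_loss] replaces the gain by [total_loss],
    which does not depend on [m] and is the exit rate. *)
Lemma mixture_balance (eta : conf) :
  (mixture a B eta * outflow (fugacity a) (fugacity B) (fun=> 1) eta =
   inflow (fugacity a) (fugacity B) (mixture a B) eta)%E.
Proof.
have fa := ltW (fugacity_gt0 a0); have fB := ltW (fugacity_gt0 (lt_trans a0 aB)).
have -> : mixture a B = fun xi : conf =>
    (c%:E * \int[mu]_(m in O) (geometric_product m xi)%:E)%E.
  by apply/funext => xi; exact: mixtureE.
rewrite inflowZ//; last by move=> xi; apply: integral_ge0 => m; exact: G0.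
rewrite -inflow_integral//.
rewrite (eq_integral
  (fun m => (geometric_product m eta * total_gain a B m eta)%:E)); last first.
  by move=> m /set_mem Om; exact: inflow_geometric.
rewrite integral_gain_loss// outflow1_total_loss// -muleA; congr (_ * _)%E.
rewrite -ge0_integralZr//.
- by move=> m; exact: G0.
- rewrite lee_fin /total_loss addr_ge0//; last first.
    by rewrite addr_ge0// ln1D_ge0// (lt_trans a0).
  by apply: sumr_ge0 => y _; rewrite mulr_ge0// hsum_ge0.
Qed.

Definition mixture_measure := discrete_measure (@mixture_ge0).

HB.instance Definition _ := Measure.on mixture_measure.

Let mixture_setT : mixture_measure setT = 1%E.
Proof. exact: esum_mixture. Qed.

HB.instance Definition _ :=
  Measure_isProbability.Build _ _ _ mixture_measure mixture_setT.

End mixture_measure.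

(** * Uniqueness *)

Section particle_number.
Context {R : realType} {n : nat}.
Local Notation conf := (config n.+1).
Implicit Types (eta xi : conf).

Lemma esum_nneseries (T : countType) (f : T -> nat -> \bar R) :
  (forall i k, (0 <= f i k)%E) ->
  (\esum_(i in [set: T]) \sum_(0 <= k <oo) f i k =
   \sum_(0 <= k <oo) \esum_(i in [set: T]) f i k)%E.
Proof.
move=> f0; rewrite esum_countType; last by move=> i; exact: nneseries_ge0.
transitivity (\sum_(0 <= j <oo) \sum_(0 <= k <oo)
    oapp (f ^~ k) 0 (@pickle_inv T j))%E.
  by apply: eq_eseriesr => j _; case: pickle_inv => //=; rewrite eseries0.
rewrite nneseries_interchange; last first.
  by move=> j k; case: (pickle_inv j) => [i|] /=; [exact: f0|].
by apply: eq_eseriesr => k _; rewrite esum_countType.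
Qed.

Lemma esum_ge_term (T : choiceType) (g : T -> \bar R) i :
  (forall j, (0 <= g j)%E) -> (g i <= \esum_(j in [set: T]) g j)%E.
Proof.
move=> g0; rewrite (esumID [set i])// setTI esum_set1//.
by apply: leeDl; exact: esum_ge0.
Qed.

Definition num_particles eta : nat := (\sum_(x < n.+1) tnth eta x)%N.

Definition is_site (p : place n) : bool := if p is inl _ then true else false.

Lemma num_particles_put k p eta : num_particles (put_in k p eta) =
  (num_particles eta + is_site p * k)%N.
Proof.
case: p => [x|b] /=; last by rewrite mul0n addn0.
rewrite mul1n /num_particles (bigD1 x)//= [in RHS](bigD1 x)//= tnth_add eqxx mul1n addnAC.
congr (_ + _ + _)%N; apply: eq_bigr => y /negbTE yx.
by rewrite tnth_add yx mul0n addn0.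
Qed.

Lemma num_particles_move k s d eta : avail k s eta ->
  (num_particles (move k s d eta) + is_site s * k = num_particles eta + is_site d * k)%N.
Proof.
move=> sk; have := num_particles_put k s (take_from k s eta); rewrite put_takeK// => ->.
by rewrite /move num_particles_put addnAC.
Qed.

Lemma leq_num_particles x eta : (tnth eta x <= num_particles eta)%N.
Proof. by rewrite /num_particles (bigD1 x)//= leq_addr. Qed.

(** The error due to annihilations when testing against t^M: bounded by 1 uniformly in [M], and
    tending to 0 as t tends to 1 for fixed [M]. *)
Definition defect (t : R) (M : nat) : R := Num.min 1 ((1 - t) * M%:R).

Lemma geometric_partial_sum (t : R) M h : (h <= M)%N ->
  (1 - t) * \sum_(1 <= k < h.+1) t ^+ (M - k) = t ^+ (M - h) - t ^+ M.
Proof.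
elim: h => [|h IH] hM; first by rewrite big_geq// mulr0 subn0 subrr.
rewrite big_nat_recr//= mulrDr IH ?(ltnW hM)//.
have -> : (M - h = (M - h.+1).+1)%N by lia.
by rewrite exprS; ring.
Qed.

(** Annihilating [k] of the [h] particles of a site turns t^M into t^(M-k). The inequality 1 - t^k
    <= k (1 - t) bounds the increase, weighted by 1/k, by (1 - t) t^(M-k); the sum of these is at
    most 1 by telescoping, and at most (1 - t) M term by term. *)
Lemma exit_sum (t : R) M h : 0 <= t <= 1 -> (h <= M)%N ->
  \sum_(1 <= k < h.+1) k%:R^-1 * t ^+ (M - k) <=
  t ^+ M * (\sum_(1 <= k < h.+1) k%:R^-1) + defect t M.
Proof.
move=> /andP[t0 t1] hM.
have term k : (1 <= k < h.+1)%N ->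
    k%:R^-1 * t ^+ (M - k) <= t ^+ M * k%:R^-1 + (1 - t) * t ^+ (M - k).
  move=> /andP[k0 kh].
  have -> : t ^+ M = t ^+ (M - k) * t ^+ k by rewrite -exprD subnK//; lia.
  have kp : 0 < k%:R :> R by rewrite ltr0n.
  have bern : 1 - t ^+ k <= k%:R * (1 - t).
    have -> : 1 - t ^+ k = (\sum_(i < k) t ^+ i) * (1 - t).
      by rewrite -[LHS]opprB subrX1; ring.
    rewrite ler_wpM2r ?subr_ge0//.
    have : \sum_(i < k) t ^+ i <= \sum_(i < k) 1.
      by apply: ler_sum => i _; exact: exprn_ile1.
    by rewrite sumr_const card_ord.
  rewrite -subr_ge0 (_ : _ - _ =
    t ^+ (M - k) * (k%:R^-1 * (k%:R * (1 - t) - (1 - t ^+ k)))).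
    apply: mulr_ge0; first exact: exprn_ge0.
    by apply: mulr_ge0; rewrite ?invr_ge0 ?ler0n ?subr_ge0.
  by field; rewrite gt_eqF.
apply: (@le_trans _ _ (\sum_(1 <= k < h.+1) (t ^+ M * k%:R^-1 + (1 - t) * t ^+ (M - k)))).
  by rewrite !big_nat; exact: ler_sum.
rewrite big_split/= -!mulr_sumr lerD2l /defect le_min; apply/andP; split.
  rewrite geometric_partial_sum//.
  have : t ^+ (M - h) <= 1 by rewrite exprn_ile1.
  have : 0 <= t ^+ M by rewrite exprn_ge0.
  lra.
rewrite ler_wpM2l ?subr_ge0//.
apply: (@le_trans _ _ (\sum_(1 <= k < h.+1) 1)).
  by apply: ler_sum => k _; rewrite exprn_ile1.
by rewrite sumr_const_nat subn1 ler_nat.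
Qed.

Lemma defect_ge0 (t : R) M : t <= 1 -> 0 <= defect t M.
Proof. by move=> t1; rewrite /defect le_min ler01 mulr_ge0 ?subr_ge0. Qed.

Definition lyapunov (t : R) (eta : conf) : R := t ^+ num_particles eta.

Lemma lyapunov_ge0 t eta : 0 <= t -> 0 <= lyapunov t eta :> R.
Proof. exact: exprn_ge0. Qed.

End particle_number.

(** * Duality of inflow and outflow, and the test function t^|eta| *)

Section uniqueness.
Context {R : realType} (n : nat) (bA bB : R).
Hypotheses (bA0 : 0 < bA) (bB0 : 0 < bB).
Local Notation conf := (config n.+1).
Local Notation inflow := (inflow bA bB).
Local Notation outflow := (outflow bA bB).
Local Notation rate := (rate bA bB).
Implicit Types (eta xi : conf) (u g : conf -> R).

Let rate0' (s : place n) k : 0 <= rate s k.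
Proof. by rewrite rate_ge0// ltW. Qed.

(* [move k s d] is a bijection from the configurations where k particles are
   available at s onto those where they are available at d. *)
Lemma inflow_outflow u g : (forall xi, 0 <= u xi) -> (forall xi, 0 <= g xi) ->
  (\esum_(eta in [set: conf]) (inflow (EFin \o u) eta * (g eta)%:E) =
   \esum_(xi in [set: conf]) ((u xi)%:E * outflow (EFin \o g) xi))%E.
Proof.
move=> u0 g0.
pose A d s k eta : \bar R :=
  (if avail k d eta then (rate s k * u (move k d s eta) * g eta)%:E else 0)%E.
pose C d s k xi : \bar R :=
  (if avail k s xi then (rate s k * u xi * g (move k s d xi))%:E else 0)%E.
have A0 d s k eta : (0 <= A d s k eta)%E.
  by rewrite /A; case: ifP => // _; apply: mulr_ge0 => //; apply: mulr_ge0.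
have C0 d s k xi : (0 <= C d s k xi)%E.
  by rewrite /C; case: ifP => // _; apply: mulr_ge0 => //; apply: mulr_ge0.
have AC d s k : adj s d ->
    (\esum_(eta in [set: conf]) A d s k eta = \esum_(xi in [set: conf]) C d s k xi)%E.
  move=> sd.
  pose D (p : place n) := [set eta | avail k p eta].
  transitivity (\esum_(eta in D d) (rate s k * u (move k d s eta) * g eta)%:E)%E.
    by rewrite [RHS]esum_mkcond; apply: eq_esum => eta _; rewrite /A mem_setE.
  transitivity (\esum_(xi in D s) (rate s k * u xi * g (move k s d xi))%:E)%E; last first.
    by rewrite esum_mkcond; apply: eq_esum => xi _; rewrite /C mem_setE.
  have ds : adj d s by rewrite adjC.
  rewrite (reindex_esum (D s) (D d) (move k s d)).
    by apply: eq_esum => xi /= xs; rewrite moveK.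
  split.
  - by move=> xi /= xs; exact: avail_move.
  - move=> x1 x2 /set_mem /= a1 /set_mem /= a2 /(congr1 (move k d s)).
    by rewrite !moveK.
  - move=> eta /= ed; exists (move k d s eta); first exact: avail_move.
    by rewrite moveK.
have term_ge0 d s eta : (0 <= \sum_(0 <= k <oo) (if avail k d eta then
    (rate s k)%:E * (EFin \o u) (move k d s eta) else 0))%E.
  by apply: nneseries_ge0 => k _ _; case: ifP => // _; rewrite mule_ge0 ?lee_fin.
have term'_ge0 d s xi : (0 <= \sum_(0 <= k <oo) (if avail k s xi then
    (rate s k)%:E * (EFin \o g) (move k s d xi) else 0))%E.
  by apply: nneseries_ge0 => k _ _; case: ifP => // _; rewrite mule_ge0 ?lee_fin.
transitivity (\esum_(eta in [set: conf]) \sum_(d : place n) \sum_(s : place n | adj s d)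
    \sum_(0 <= k <oo) A d s k eta)%E.
  apply: eq_esum => eta _; rewrite /inflow/= ge0_sume_distrl; last first.
    by move=> d _; apply: sume_ge0 => s _; exact: term_ge0.
  apply: eq_bigr => d _; rewrite ge0_sume_distrl; last by move=> s _; exact: term_ge0.
  apply: eq_bigr => s _; rewrite muleC -nneseriesZl; last first.
    by move=> k _; case: ifP => // _; rewrite mule_ge0 ?lee_fin.
  apply: eq_eseriesr => k _; rewrite /A; case: ifP => _; last by rewrite mule0.
  by rewrite /= -!EFinM mulrC.
transitivity (\sum_(d : place n) \sum_(s : place n | adj s d)
    \sum_(0 <= k <oo) \esum_(xi in [set: conf]) C d s k xi)%E.
  rewrite esum_sum; last first.
    by move=> eta d _ _; apply: sume_ge0 => s _; exact: nneseries_ge0.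
  apply: eq_bigr => d _; rewrite esum_sum; last by move=> eta s _ _; exact: nneseries_ge0.
  apply: eq_bigr => s sd; rewrite esum_nneseries//.
  by apply: eq_eseriesr => k _; rewrite AC.
rewrite (exchange_big_dep xpredT)//=.
transitivity (\esum_(xi in [set: conf]) \sum_(s : place n) \sum_(d : place n | adj s d)
    \sum_(0 <= k <oo) C d s k xi)%E.
  rewrite esum_sum; last first.
    by move=> eta d _ _; apply: sume_ge0 => s _; exact: nneseries_ge0.
  apply: eq_bigr => s _; rewrite esum_sum; last by move=> eta d _ _; exact: nneseries_ge0.
  by apply: eq_bigr => d _; rewrite esum_nneseries.
apply: eq_esum => xi _; rewrite /outflow ge0_sume_distrr; last first.
  by move=> s _; apply: sume_ge0 => d _; exact: term'_ge0.
apply: eq_bigr => s _; rewrite ge0_sume_distrr; last by move=> d _; exact: term'_ge0.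
apply: eq_big => [d|d _]; first by rewrite adjC.
rewrite -nneseriesZl; last by move=> k _; case: ifP => // _; rewrite mule_ge0 ?lee_fin.
apply: eq_eseriesr => k _; rewrite /C; case: ifP => _; last by rewrite mule0.
by rewrite /= -!EFinM mulrCA mulrA.
Qed.

(** A jump into a site conserves or increases the number of particles, so it cannot increase
    [lyapunov t]; jumps into a reservoir are controlled by [exit_sum]. *)
Lemma outflow_lyapunov (t : R) xi : 0 <= t <= 1 ->
  (outflow (EFin \o lyapunov t) xi <=
   outflow (fun=> 1) xi * (lyapunov t xi)%:E + (2 * defect t (num_particles xi))%:E)%E.
Proof.
move=> /[dup] t01 /andP[t0 t1].
have pt k : 0 <= t ^+ k by exact: exprn_ge0.
pose T1 (s d : place n) : \bar R := (\sum_(0 <= k <oo)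
  (if avail k s xi then (rate s k)%:E * 1 else 0))%E.
have T1_ge0 s d : (0 <= T1 s d)%E.
  by apply: nneseries_ge0 => k _ _; case: ifP => // _; rewrite mule1 lee_fin.
(* The error is charged only to jumps into a reservoir. Each reservoir touches one site, so the two
   of them give the factor 2. *)
pose delta (d : place n) : \bar R :=
  if is_site d then 0%E else (defect t (num_particles xi))%:E.
have T_le s d : adj d s ->
    (\sum_(0 <= k <oo) (if avail k s xi then
       (rate s k)%:E * (EFin \o lyapunov t) (move k s d xi) else 0) <=
     T1 s d * (lyapunov t xi)%:E + delta d)%E.
  case: d => [y|b] ds; rewrite /delta /=.
    rewrite adde0 muleC -nneseriesZl; last first.
      by move=> k _; case: ifP => // _; rewrite mule1 lee_fin.
    apply: lee_nneseries => k.
      by move=> _ _; case: ifP => // _; rewrite /= -EFinM lee_fin;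
        apply: mulr_ge0 => //; exact: pt.
    move=> _; case: ifP => [av|_]; last by rewrite mule0.
    rewrite mule1 -!EFinM lee_fin mulrC ler_wpM2r// /lyapunov.
    rewrite ler_wiXn2l//.
    have /= := num_particles_move (inl y) av; case: (is_site s); lia.
  case: s ds => [x|//] _.
  have avE k : avail k (inl x) xi = (k <= tnth xi x)%N by [].
  have T1E : T1 (inl x) (inr b) = (\sum_(1 <= k < (tnth xi x).+1) k%:R^-1)%:E.
    rewrite /T1 /= nneseries_if_leq.
    - by rewrite -sumEFin; apply: eq_bigr => k _; rewrite mule1 /rate /= expr1n mul1r.
    - by rewrite rate0 mul0e.
    - by move=> k; rewrite mule1 lee_fin.
  rewrite T1E.
  rewrite (_ : (\sum_(0 <= k <oo) _)%E =
    (\sum_(1 <= k < (tnth xi x).+1) k%:R^-1 * t ^+ (num_particles xi - k))%:E).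
    by rewrite -EFinM -EFinD lee_fin /lyapunov [X in X + _]mulrC exit_sum// leq_num_particles.
  transitivity (\sum_(0 <= k <oo) (if (k <= tnth xi x)%N then
     (k%:R^-1 * t ^+ (num_particles xi - k))%:E else 0))%E.
    apply: eq_eseriesr => k _; rewrite avE; case: ifP => // av.
    rewrite /= -EFinM /lyapunov /rate /= expr1n mul1r; congr (_ * t ^+ _)%:E.
    have /= := @num_particles_move n k (inl x) (inr b) xi av; lia.
  rewrite nneseries_if_leq.
  - by rewrite sumEFin.
  - by rewrite invr0 mul0r.
  - by move=> k; rewrite lee_fin mulr_ge0 ?invr_ge0.
apply: (@le_trans _ _ (\sum_(s : place n) \sum_(d | adj d s)
    (T1 s d * (lyapunov t xi)%:E + delta d))%E).
  by apply: lee_sum => s _; apply: lee_sum => d; exact: T_le.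
under eq_bigr do rewrite big_split/=.
rewrite big_split/=; apply: leeD.
  rewrite /outflow ge0_sume_distrl; last first.
    by move=> s _; apply: sume_ge0 => d _; exact: T1_ge0.
  apply: lee_sum => s _; rewrite ge0_sume_distrl// => d _; exact: T1_ge0.
rewrite (exchange_big_dep xpredT)//= (@big_place _ _ _ xpredT).
rewrite big1 ?add0e; last by move=> y _; rewrite big1.
rewrite big_bool.
have dr b : (\sum_(s | adj (inr b) s) delta (inr b) = (defect t (num_particles xi))%:E)%E.
  under eq_bigl do rewrite adjC.
  by rewrite big_adj_reservoir.
by rewrite !dr /= -EFinD lee_fin; lra.
Qed.

End uniqueness.

(** * A summable subsolution of the balance equation is a solution *)

Section subsolutions.
Context {R : realType} (n : nat).
Variables (a B : R).
Hypotheses (a0 : 0 < a) (aB : a < B).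
Local Notation conf := (config n.+1).
Local Notation inflow := (inflow (fugacity a) (fugacity B)).
Local Notation outflow := (outflow (fugacity a) (fugacity B)).
Implicit Types (eta xi : conf) (u : conf -> R).

Let fa : 0 < fugacity a. Proof. exact: fugacity_gt0. Qed.
Let fB : 0 < fugacity B. Proof. by apply: fugacity_gt0; exact: lt_trans aB. Qed.

Lemma total_loss_ge0 eta : 0 <= total_loss a B eta.
Proof.
rewrite addr_ge0//; last by rewrite addr_ge0// ln1D_ge0// (lt_trans a0).
by apply: sumr_ge0 => y _; rewrite mulr_ge0// hsum_ge0.
Qed.

(** The exit rate grows at most linearly in the number M of particles, because [hsum k 1 <= k], and
    M t^M is bounded for fixed t below 1. *)
Lemma total_loss_lyapunov_bounded (t : R) : 0 <= t < 1 ->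
  exists K : R, forall eta, total_loss a B eta * lyapunov t eta <= K.
Proof.
move=> /andP[t0 t1]; exists (ln (1 + a) + ln (1 + B) + 2 / (1 - t)) => eta.
have t1' : 0 < 1 - t by rewrite subr_gt0.
have tM k : t ^+ k <= 1 by rewrite exprn_ile1// ltW.
have h1 k : hsum k 1 <= k%:R :> R.
  rewrite hsumE -[leRHS]mulr1 mulr_natl -[X in _ *+ X](card_ord k) -sumr_const.
  apply: ler_sum => i _; rewrite expr1n div1r invf_le1 ?ltr0n//.
  by rewrite ler1n.
have L : total_loss a B eta <= ln (1 + a) + ln (1 + B) + 2 * (num_particles eta)%:R.
  rewrite /total_loss addrC lerD2l /num_particles natr_sum -mulr_sumr ler_wpM2l//.
  by apply: ler_sum => y _; exact: h1.
(* Each of the M terms t^(M-k) with 1 <= k <= M is at least t^M, and (1 - t) times their sum is 1 -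
   t^M. *)
have MtM : (1 - t) * ((num_particles eta)%:R * t ^+ num_particles eta) <= 1.
  have := geometric_partial_sum t (leqnn (num_particles eta)).
  rewrite subnn expr0 => E.
  apply: (@le_trans _ _ (1 - t ^+ num_particles eta)); last by rewrite lerBlDl lerDr exprn_ge0.
  rewrite -E ler_wpM2l ?(ltW t1')//.
  rewrite mulr_natl -[X in _ *+ X](subn1 (num_particles eta).+1) -sumr_const_nat.
  rewrite !big_nat; apply: ler_sum => k /andP[k0 kM].
  by rewrite ler_wiXn2l// ?(ltW t1)// leq_subr.
have l0 : 0 <= ln (1 + a) + ln (1 + B).
  by rewrite addr_ge0// ln1D_ge0// (lt_trans a0).
rewrite /lyapunov; apply: (@le_trans _ _
  ((ln (1 + a) + ln (1 + B) + 2 * (num_particles eta)%:R) * t ^+ num_particles eta)).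
  by rewrite ler_wpM2r// exprn_ge0.
rewrite mulrDl lerD//; first by rewrite -[leRHS]mulr1 ler_wpM2l.
by rewrite ler_pdivlMr//; move: MtM; lra.
Qed.

Variable u : conf -> R.
Hypotheses (u0 : forall eta, 0 <= u eta).
Hypothesis (u_sum : (\esum_(eta in [set: conf]) (u eta)%:E < +oo)%E).
Hypothesis (u_sub : forall eta,
  ((total_loss a B eta * u eta)%:E <= inflow (EFin \o u) eta)%E).

(** The slack in the subsolution inequality, to be shown equal to 0. *)
Let w eta : \bar R := (inflow (EFin \o u) eta - (total_loss a B eta * u eta)%:E)%E.

Let w0 eta : (0 <= w eta)%E.
Proof. by rewrite /w sube_ge0. Qed.

Let inflowE eta : inflow (EFin \o u) eta = (w eta + (total_loss a B eta * u eta)%:E)%E.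
Proof. by rewrite /w subeK. Qed.

(** The inflow is summed against [lyapunov t] and transposed by [inflow_outflow]. The exit-rate term
    [X] then appears on both sides and cancels, leaving the slack against the annihilation error. *)
Lemma defect_bound (t : R) eta : 0 <= t < 1 ->
  (w eta * (lyapunov t eta)%:E <=
   \esum_(xi in [set: conf]) (u xi * (2 * defect t (num_particles xi)))%:E)%E.
Proof.
move=> /[dup] t01 /andP[t0 t1].
have l0 xi := lyapunov_ge0 xi t0.
apply: (@le_trans _ _ (\esum_(xi in [set: conf]) (w xi * (lyapunov t xi)%:E))%E).
  apply: (@esum_ge_term _ _ (fun xi => w xi * (lyapunov t xi)%:E)%E) => xi.
  by rewrite mule_ge0 ?lee_fin.
have [K HK] := total_loss_lyapunov_bounded t01.
pose X := (\esum_(xi in [set: conf]) (u xi * (total_loss a B xi * lyapunov t xi))%:E)%E.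
have X0 : (0 <= X)%E.
  by apply: esum_ge0 => xi _; rewrite lee_fin !mulr_ge0// total_loss_ge0.
(* Finiteness of [X] permits the cancellation: [K] bounds the product of exit rate and test
   function, and [u] is summable. *)
have Xfin : X \is a fin_num.
  rewrite ge0_fin_numE//.
  apply: (@le_lt_trans _ _ ((Num.max K 0)%:E * \esum_(xi in [set: conf]) (u xi)%:E)%E).
    rewrite -esumZl; last by rewrite le_max lexx orbT.
      apply: le_esum => xi _; rewrite -EFinM lee_fin mulrC ler_wpM2r//.
      by rewrite (le_trans (HK xi))// le_max lexx.
    by move=> xi; rewrite lee_fin.
  by rewrite lte_mul_pinfty// lee_fin le_max lexx orbT.
have hA xi : (0 <= (u xi * (total_loss a B xi * lyapunov t xi))%:E)%E.
  by rewrite lee_fin mulr_ge0// mulr_ge0// total_loss_ge0.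
have hB xi : (0 <= (u xi * (2 * defect t (num_particles xi)))%:E)%E.
  by rewrite lee_fin mulr_ge0// mulr_ge0// defect_ge0// ltW.
have hC xi : (0 <= w xi * (lyapunov t xi)%:E)%E by rewrite mule_ge0 ?lee_fin.
rewrite -(leeD2lE _ _ Xfin) /X -!esumD//.
have -> : (\esum_(xi in [set: conf]) ((u xi * (total_loss a B xi * lyapunov t xi))%:E +
    w xi * (lyapunov t xi)%:E) =
    \esum_(xi in [set: conf]) (inflow (EFin \o u) xi * (lyapunov t xi)%:E))%E.
  apply: eq_esum => xi _; rewrite inflowE.
  move: (w xi) (w0 xi) => wx wx0; rewrite ge0_muleDl//; last first.
    by rewrite lee_fin mulr_ge0// total_loss_ge0.
  by rewrite addeC -EFinM mulrCA mulrA.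
rewrite inflow_outflow//.
apply: le_esum => xi _; rewrite -EFinD -mulrDr EFinM lee_wpmul2l ?lee_fin//.
rewrite EFinD EFinM -outflow1_total_loss//; apply: outflow_lyapunov => //.
by rewrite t0 ltW.
Qed.

(** Dominated convergence by hand: outside finitely many configurations the defect is bounded by 1
    and the mass of [u] is small; on the finite remainder the factor 1 - t is chosen small. *)
Lemma esum_defect_small (e : R) : 0 < e -> exists t : R, [/\ 2^-1 <= t, t < 1 &
  (\esum_(xi in [set: conf]) (u xi * (2 * defect t (num_particles xi)))%:E <= e%:E)%E].
Proof.
move=> e0.
pose p k : \bar R := oapp (EFin \o u) 0%E (@pickle_inv conf k).
have p0 k : (0 <= p k)%E by rewrite /p; case: pickle_inv => [xi|] //=; rewrite lee_fin.
have psum : (\sum_(0 <= k <oo) p k < +oo)%E by rewrite -esum_countType.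
have /fine_cvgP[tfin tcv] := @nneseries_tail_cvg R p xpredT psum (fun k _ => p0 k).
have e4 : 0 < e / 4 by rewrite divr_gt0.
have [N _ /(_ N (leqnn N))/= [Nfin Ne]] : \forall N \near \oo,
    (\sum_(N <= k <oo) p k)%E \is a fin_num /\ fine (\sum_(N <= k <oo) p k)%E < e / 4.
  near=> N; split; near: N; first exact: tfin.
  exact: (cvgr_lt _ tcv).
pose c k : R := oapp (fun xi => u xi * (num_particles xi)%:R) 0 (@pickle_inv conf k).
have c0 k : 0 <= c k by rewrite /c; case: pickle_inv => //= xi; rewrite mulr_ge0.
pose C := \sum_(0 <= k < N) c k.
have C0 : 0 <= C by exact: sumr_ge0.
(* Witness t = 1 - d: the first bound ensures t >= 1/2, the second gives d C <= e / 4, with C + 1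
   keeping the denominator positive. The finite part and the tail each contribute at most e / 2. *)
pose d := Num.min 2^-1 (e / (4 * (C + 1))).
have d0 : 0 < d by rewrite lt_min invr_gt0 ltr0n /= divr_gt0// mulr_gt0//; lra.
have dC : d * C <= e / 4.
  apply: (@le_trans _ _ (e / (4 * (C + 1)) * C)).
    by rewrite ler_wpM2r// ge_min lexx orbT.
  by rewrite invfM mulrA -[leRHS]mulr1 -mulrA ler_wpM2l ?(ltW e4)// ler_pdivrMl; lra.
have d2 : d <= 2^-1 by rewrite ge_min lexx.
exists (1 - d); split; [lra|lra|].
pose f k : \bar R :=
  oapp (fun xi => (u xi * (2 * defect (1 - d) (num_particles xi)))%:E) 0%E (@pickle_inv conf k).
have fxi xi : (0 <= (u xi * (2 * defect (1 - d) (num_particles xi)))%:E)%E.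
  by rewrite lee_fin mulr_ge0// mulr_ge0// defect_ge0//; lra.
have f_ge0 k : (0 <= f k)%E by rewrite /f; case: pickle_inv.
have fp k : (f k <= 2%:E * p k)%E.
  rewrite /f /p; case: pickle_inv => [xi|] /=; last by rewrite mule0.
  rewrite -EFinM lee_fin mulrCA ler_wpM2l// -[leRHS]mulr1 ler_wpM2l//.
  by rewrite ge_min lexx.
rewrite (esum_countType fxi) -/f.
rewrite (nneseries_split _ N); last by move=> k _; exact: f_ge0.
rewrite add0n.
have -> : e = e / 2 + e / 2 by lra.
rewrite EFinD; apply: leeD.
  apply: (@le_trans _ _ (\sum_(0 <= k < N) (2 * d * c k)%:E)%E).
    apply: lee_sum => k _; rewrite /f /c; case: pickle_inv => [xi|] /=; last by rewrite mulr0.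
    rewrite lee_fin mulrCA -mulrA ler_wpM2l// mulrCA ler_wpM2l//.
    by rewrite ge_min subKr lexx orbT.
  by rewrite sumEFin lee_fin -mulr_sumr -mulrA; move: dC; rewrite -/C; lra.
apply: (@le_trans _ _ (2%:E * \sum_(N <= k <oo) p k)%E).
  rewrite -nneseriesZl; last by move=> k _; exact: p0.
  by apply: lee_nneseries => k *; [exact: f_ge0|exact: fp].
by rewrite -(fineK Nfin) -EFinM lee_fin; lra.
Unshelve. all: by end_near. Qed.

Lemma subsolution_balance eta :
  inflow (EFin \o u) eta = (total_loss a B eta * u eta)%:E.
Proof.
rewrite inflowE -[RHS]add0e; congr (_ + _)%E; apply/eqP; rewrite eq_le w0 andbT.
(* Since t >= 1/2, [h] bounds the test function at [eta] from below independently of t. *)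
pose h : R := 2^-1 ^+ num_particles eta.
have h0 : 0 < h by rewrite exprn_gt0.
have wh e : 0 < e -> (w eta * h%:E <= e%:E)%E.
  move=> /esum_defect_small[t [ht t1 te]].
  have t0 : 0 <= t by apply: le_trans ht; rewrite invr_ge0.
  apply: le_trans te; apply: le_trans (defect_bound eta _); last by rewrite t0.
  by rewrite lee_wpmul2l// lee_fin lerXn2r// nnegrE invr_ge0.
have : (w eta * h%:E <= 0)%E.
  by apply/lee_addgt0Pr => e e0; rewrite add0e; exact: wh.
by rewrite pmule_lle0// lte_fin.
Qed.

End subsolutions.

(** * Irreducibility: a nonempty set closed under reversed unit moves contains every
    configuration *)

Section closed_sets.
Variable n : nat.
Local Notation conf := (config n.+1).
Implicit Types (eta xi : conf).

Lemma take_putK k s eta : take_from k s (put_in k s eta) = eta.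
Proof.
case: s => //= x; apply: eq_from_tnth => y.
by rewrite tnth_remove tnth_add addnK.
Qed.

Variable Z : conf -> Prop.
Hypothesis Z_move : forall eta s d, adj s d -> avail 1 d eta -> Z eta ->
  Z (move 1 d s eta).

(** Induction on the position of the site: the first one exchanges particles with the left
    reservoir, and a particle at any other site is exchanged with the site on its left. *)
Lemma closed_add (x : 'I_n.+1) eta : Z eta <-> Z (add_particles 1 x eta).
Proof.
have avail_add y xi : avail 1 (inl y) (add_particles 1 y xi).
  by rewrite /= tnth_add eqxx mul1n leq_addl.
have moveE y (p : place n) xi :
    move 1 (inl y) p (add_particles 1 y xi) = put_in 1 p xi.
  by rewrite /move -[add_particles 1 y xi]/(put_in 1 (inl y) xi) take_putK.
have [k kx] := ubnP (x : nat); elim: k x kx eta => // k IH x xk eta.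
have [x0|x0] := eqVneq (x : nat) 0%N.
  have xE : x = end_site n false by exact: val_inj.
  have xr : adj (inl x) (inr false) by rewrite /= xE.
  split=> [Zeta|Zx]; first exact: (Z_move (eta := eta) xr isT Zeta).
  rewrite adjC in xr.
  by have := Z_move xr (avail_add x eta) Zx; rewrite moveE.
have xp : (x.-1 < n.+1)%N by have := ltn_ord x; lia.
pose y := Ordinal xp.
have yx : adj (inl x) (inl y) by rewrite /= prednK ?eqxx ?orbT// lt0n.
have yk : (y < k)%N by rewrite /=; lia.
rewrite (IH y yk); split => [Zy|Zx].
  by have := Z_move yx (avail_add y eta) Zy; rewrite moveE.
rewrite adjC in yx.
by have := Z_move yx (avail_add x eta) Zx; rewrite moveE.
Qed.

(** Every configuration is linked to the empty one by removing its particles one at a time. *)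
Lemma closed_all eta xi : Z eta -> Z xi.
Proof.
pose zero : conf := [tuple 0%N | _ < n.+1].
have Zzero zeta : Z zeta <-> Z zero.
  have [k kz] := ubnP (num_particles zeta); elim: k zeta kz => // k IH zeta kz.
  have [/existsP[x x0]|] := boolP [exists x, (0 < tnth zeta x)%N].
    have zE := @put_takeK _ 1 (inl x) zeta x0.
    rewrite -zE /= -closed_add; apply: IH.
    by have := num_particles_put 1 (inl x) (take_from 1 (inl x) zeta); rewrite zE /=; lia.
  rewrite negb_exists => /forallP z0; suff -> : zeta = zero by [].
  by apply: eq_from_tnth => x; rewrite tnth_mktuple; have := z0 x; rewrite lt0n negbK => /eqP.
by move=> /Zzero Z0; apply/Zzero.
Qed.

End closed_sets.

(** * Positivity and monotonicity of the inflow *)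

Section irreducibility.
Context {R : realType} (n : nat) (bA bB : R).
Hypotheses (bA0 : 0 < bA) (bB0 : 0 < bB).
Local Notation conf := (config n.+1).
Implicit Types (eta xi : conf) (u p q : conf -> R).

Let term_ge0 u d s eta k : (forall xi, 0 <= u xi) ->
  (0 <= if avail k d eta then (rate bA bB s k)%:E * (EFin \o u) (move k d s eta) else 0)%E.
Proof.
by move=> u0; case: ifP => // _; rewrite mule_ge0 ?lee_fin// rate_ge0// ltW.
Qed.

Lemma inflow_ge0 u eta : (forall xi, 0 <= u xi) ->
  (0 <= inflow bA bB (EFin \o u) eta)%E.
Proof.
move=> u0; apply: sume_ge0 => d _; apply: sume_ge0 => s _.
by apply: nneseries_ge0 => k _ _; exact: term_ge0.
Qed.

(** All terms of the inflow are nonnegative and all rates with [k > 0] are positive, so zeros of [u]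
    propagate to predecessors. *)
Lemma inflow_eq0 u eta d s k : (forall xi, 0 <= u xi) ->
  inflow bA bB (EFin \o u) eta = 0%E ->
  adj s d -> avail k d eta -> (0 < k)%N -> u (move k d s eta) = 0.
Proof.
move=> u0 I0 sd dk k0; apply/eqP; rewrite eq_le u0 andbT.
have r0 : 0 < rate bA bB s k.
  by rewrite divr_gt0 ?ltr0n// exprn_gt0//; case: s {sd} => [x|[]].
suff : ((rate bA bB s k * u (move k d s eta))%:E <= inflow bA bB (EFin \o u) eta)%E.
  by rewrite I0 lee_fin pmulr_rle0.
rewrite /inflow.
rewrite (bigD1 d)//= (bigD1 s)//= (@nneseriesD1 _ _ k)//; last by move=> j _; exact: term_ge0.
rewrite dk EFinM -!addeA; apply: leeDl; apply: adde_ge0.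
  by apply: nneseries_ge0 => j _ _; exact: term_ge0.
apply: adde_ge0.
  by apply: sume_ge0 => s' _; apply: nneseries_ge0 => j _ _; exact: term_ge0.
apply: sume_ge0 => d' _; apply: sume_ge0 => s' _.
by apply: nneseries_ge0 => j _ _; exact: term_ge0.
Qed.

Lemma inflow_le_add p q u eta :
  (forall xi, 0 <= p xi) -> (forall xi, 0 <= q xi) -> (forall xi, 0 <= u xi) ->
  (forall xi, p xi <= q xi + u xi) ->
  (inflow bA bB (EFin \o p) eta <=
   inflow bA bB (EFin \o q) eta + inflow bA bB (EFin \o u) eta)%E.
Proof.
move=> p0 q0 u0 pqu; rewrite /inflow -big_split/=; apply: lee_sum => d _.
rewrite -big_split/=; apply: lee_sum => s _.
rewrite -nneseriesD; [|by move=> k _ _; exact: term_ge0|by move=> k _ _; exact: term_ge0].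
apply: lee_nneseries => k; first by move=> _ _; exact: term_ge0.
move=> _; case: ifP => _; last by rewrite adde0.
rewrite /= -!EFinM -EFinD lee_fin -mulrDr ler_wpM2l//.
by rewrite rate_ge0// ltW.
Qed.

End irreducibility.

(** * Comparison of two stationary probabilities *)

Section uniqueness.
Context {R : realType} (n : nat).
Variables (a B : R).
Hypotheses (a0 : 0 < a) (aB : a < B).
Local Notation conf := (config n.+1).

Let fa : 0 < fugacity a. Proof. exact: fugacity_gt0. Qed.
Let fB : 0 < fugacity B. Proof. by apply: fugacity_gt0; exact: lt_trans aB. Qed.

Lemma stationaryE (mu : {measure set conf -> \bar R}) :
  stationary (fugacity a) (fugacity B) mu <-> forall eta : conf,
  (mu [set eta] * outflow (fugacity a) (fugacity B) (fun=> 1) eta =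
   inflow (fugacity a) (fugacity B) (fun xi => mu [set xi]) eta)%E.
Proof.
have fa' := ltW fa; have fB' := ltW fB.
by split=> H eta; have := H eta; rewrite -(outflow1E fa' fB')
  -(inflowE fa' fB' eta (fun xi => measure_ge0 mu [set xi])).
Qed.

Lemma stationary_unique (mu nu : probability conf R) :
  stationary (fugacity a) (fugacity B) mu ->
  stationary (fugacity a) (fugacity B) nu -> forall A, mu A = nu A.
Proof.
move=> /stationaryE smu /stationaryE snu.
pose p eta := fine (mu [set eta]); pose q eta := fine (nu [set eta]).
have pE eta : mu [set eta] = (p eta)%:E.
  by rewrite fineK// fin_num_measure//; exact: measurable_config.
have qE eta : nu [set eta] = (q eta)%:E.
  by rewrite fineK// fin_num_measure//; exact: measurable_config.
have p0 eta : 0 <= p eta by rewrite -lee_fin -pE measure_ge0.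
have q0 eta : 0 <= q eta by rewrite -lee_fin -qE measure_ge0.
pose u eta := Num.max (p eta - q eta) 0.
have u0 eta : 0 <= u eta by rewrite le_max lexx orbT.
have up eta : u eta <= p eta by rewrite ge_max p0 lerBlDr lerDl q0.
have bal r (P : probability conf R) eta : (forall xi, P [set xi] = (r xi)%:E) ->
    (forall xi : conf, (P [set xi] * outflow (fugacity a) (fugacity B) (fun=> 1) xi =
     inflow (fugacity a) (fugacity B) (fun zeta => P [set zeta]) xi)%E) ->
    inflow (fugacity a) (fugacity B) (EFin \o r) eta = (total_loss a B eta * r eta)%:E.
  move=> rE /(_ eta); rewrite rE outflow1_total_loss// -EFinM mulrC => ->.
  by congr inflow; apply/funext => xi /=; rewrite rE.
have u_sum : (\esum_(eta in [set: conf]) (u eta)%:E < +oo)%E.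
  apply: (@le_lt_trans _ _ (\esum_(eta in [set: conf]) mu [set eta])%E).
    by apply: le_esum => eta _; rewrite pE lee_fin.
  have -> : (\esum_(eta in [set: conf]) mu [set eta] = 1)%E.
    by rewrite -measure_esum; exact: probability_setT.
  exact: ltry.
(* Where p <= q the left-hand side is 0. Elsewhere u = p - q, and the balance equations of p and q
   are subtracted, using p <= q + u everywhere. *)
have u_sub eta : ((total_loss a B eta * u eta)%:E <=
    inflow (fugacity a) (fugacity B) (EFin \o u) eta)%E.
  have [pq|qp] := leP (p eta) (q eta).
    have -> : u eta = 0 by apply/max_idPr; rewrite subr_le0.
    by rewrite mulr0 inflow_ge0.
  have -> : u eta = p eta - q eta by apply/max_idPl; rewrite subr_ge0 ltW.
  have pqu xi : p xi <= q xi + u xi by rewrite -lerBlDl le_max lexx.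
  have := inflow_le_add fa fB eta p0 q0 u0 pqu.
  rewrite (bal p mu)// (bal q nu)//.
  by rewrite mulrBr EFinB leeBlDl.
have u_bal := subsolution_balance a0 aB u0 u_sum u_sub.
(* By [u_bal] a zero of [u] has zero inflow, so the zero set is closed under reversed moves. One
   zero therefore forces u = 0 everywhere, that is p <= q. *)
have [[eta ueta]|u_pos] := pselect (exists eta, u eta = 0).
  apply: measure_config_eq => xi.
  have : u xi = 0.
    apply: (@closed_all _ (fun zeta => u zeta = 0) _ eta) => //.
    move=> zeta s d sd dz uz; apply: (inflow_eq0 fa fB u0 _ sd dz) => //.
    by rewrite u_bal uz mulr0.
  rewrite pE qE lee_fin => uxi; rewrite -subr_le0 -uxi.
  by rewrite le_max lexx.
(* Without zeros, p > q at every configuration, and the comparison runs the other way. *)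
move=> A; apply/esym; apply: measure_config_eq => xi.
rewrite pE qE lee_fin leNgt; apply/negP => pq; apply: u_pos; exists xi.
by apply/max_idPr; rewrite subr_le0 ltW.
Qed.

End uniqueness.

(** Identifies the reservoir parameters with the fugacities of the reservoir means. *)
Lemma fugacityK (R : realType) (b : R) : b < 1 -> fugacity (b / (1 - b)) = b.
Proof. by move=> b1; rewrite /fugacity; field; lra. Qed.

Theorem theorem2p1 (R : realType) (n : nat) (betaA betaB : R)
    (betaA_gt0 : 0 < betaA) (betaA_lt_betaB : betaA < betaB)
    (betaB_lt1 : betaB < 1) :
  let N := n.+1 in
  let rhoA := betaA / (1 - betaA) in
  let rhoB := betaB / (1 - betaB) in
  lebesgue_tuple N (ordered_means rhoA rhoB) = ((rhoB - rhoA) ^+ N / N`!%:R)%:E /\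
  exists mu : probability (config N) R,
    [/\ forall eta : config N, mu [set eta] = mixture rhoA rhoB eta,
        stationary betaA betaB mu
      & forall nu : probability (config N) R, stationary betaA betaB nu ->
          forall A : set (config N), measurable A -> nu A = mu A].
Proof.
move=> N rhoA rhoB.
have betaA_lt1 := lt_trans betaA_lt_betaB betaB_lt1.
have rhoA0 : 0 < rhoA by rewrite divr_gt0// subr_gt0.
have rhoAB : rhoA < rhoB.
  by rewrite /rhoA /rhoB ltr_pdivrMr ?subr_gt0// mulrAC ltr_pdivlMr ?subr_gt0//; lra.
have fA : fugacity rhoA = betaA by exact: fugacityK.
have fB : fugacity rhoB = betaB by exact: fugacityK.
split; first exact: lebesgue_ordered_means (ltW rhoAB).
pose mu : probability (config N) R := mixture_measure rhoA0 rhoAB.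
have muE eta : mu [set eta] = mixture rhoA rhoB eta by exact: discrete_measure1.
have mu_stat : stationary betaA betaB mu.
  rewrite -fA -fB; apply/(stationaryE rhoA0 rhoAB) => eta.
  have muF : mixture rhoA rhoB = fun xi : config N => mu [set xi].
    by apply/funext => xi; rewrite muE.
  by have := mixture_balance rhoA0 rhoAB eta; rewrite muF.
exists mu; split => // nu nu_stat A _.
by apply: (stationary_unique rhoA0 rhoAB); rewrite fA fB.
Qed.
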